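(* Let $\Bbbk$ be a field, let $G$ be a connected finite simple graph, and let $\mathcal{I}_G\subseteq\Bbbk[x_i,y_i:i\in V(G)]$ be its parity binomial edge ideal. The minimal primes of $\mathcal{I}_G$ are exactly the ideals $\mathfrak{m}_S+\mathfrak{p}$, where $S\subseteq V(G)$ is a disconnector of $G$ and $\mathfrak{p}$ is a sign-split minimal prime of $\mathcal{J}_{G_S}$.
   Context: Graphs are finite and simple. For a graph $H$ with vertex set $V(H)$ and edge set $E(H)$, the parity binomial edge ideal is $\mathcal{I}_H=\langle x_ix_j-y_iy_j:\{i,j\}\in E(H)\rangle\subseteq\Bbbk[x_i,y_i:i\in V(H)]$, and $\mathcal{J}_H:=\mathcal{I}_H:\bigl(\prod_{i\in V(H)}x_iy_i\bigr)^\infty$. Ideals of a polynomial subring of $\Bbbk[x_i,y_i:i\in V(G)]$ are identified with the ideals they generate in $\Bbbk[x_i,y_i:i\in V(G)]$, and ideals not using some of the indeterminates are regarded as ideals of the respective subrings. For $S\subseteq V(G)$, $G_S$ is the induced subgraph of $G$ on $V(G)\setminus S$, and $\mathfrak{m}_S:=\langle x_s,y_s:s\in S\rangle$. For a graph $H$, let $c(H)$ be the number of connected components, $c_0(H)$ the number of bipartite connected components (an isolated vertex is bipartite), $c_1(H)$ the number of connected components containing an odd cycle, and $\mathfrak{s}(H):=c_0(H)+c(H)=2c_0(H)+c_1(H)$. A set $S\subseteq V(G)$ is a *disconnector* of $G$ if $\mathfrak{s}(G_S)>\mathfrak{s}(G_{S\setminus\{s\}})$ for every $s\in S$ (in particular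 $\emptyset$ is a disconnector). For a connected non-bipartite graph $N$, put $\mathfrak{p}^+(N):=\langle x_i+y_i:i\in V(N)\rangle$ and $\mathfrak{p}^-(N):=\langle x_i-y_i:i\in V(N)\rangle$. If $B_1,\dots,B_{c_0(G_S)}$ are the bipartite and $N_1,\dots,N_{c_1(G_S)}$ the non-bipartite connected components of $G_S$, then the minimal primes of $\mathcal{J}_{G_S}$ are the ideals $\sum_{i}\mathcal{J}_{B_i}+\sum_{i}\mathfrak{p}^{\sigma_i}(N_i)$, where $\sigma_i\in\{+,-\}$ are arbitrary if $\operatorname{char}(\Bbbk)\ne2$, and all $\sigma_i=+$ if $\operatorname{char}(\Bbbk)=2$ (where $\mathfrak{p}^+=\mathfrak{p}^-$). For a disconnector $S$ and $s\in S$, let $\mathcal{C}_{G_S}(s)$ be the set of those connected components of $G_S$ which are joined to $s$ in $G_{S\setminus\{s\}}$, i.e. which contain a neighbour of $s$. A minimal prime $\mathfrak{p}=\sum_{i}\mathcal{J}_{B_i}+\sum_{i}\mathfrak{p}^{\sigma_i}(N_i)$ of $\mathcal{J}_{G_S}$ is *sign-split* if for every $s\in S$ such that $\mathcal{C}_{G_S}(s)$ contains no bipartite graph, the signs $\sigma_i$ of the components $N_i\in\mathcal{C}_{G_S}(s)$ are neither all $+$ nor all $-$. (Thus, if $\operatorname{char}(\Bbbk)=2$, the prime is sign-split only if $\mathcal{C}_{G_S}(s)$ contains a bipartite component for every $s\in S$.) *)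

(* Defs.v *)
From HB Require Import structures.
From mathcomp Require Import all_boot all_order all_algebra ring_quotient.
From mathcomp Require Import boolp classical_sets.
From mathcomp Require Import mpoly.

Set Implicit Arguments.
Unset Strict Implicit.
Unset Printing Implicit Defensive.

Import GRing.Theory.

Local Open Scope ring_scope.
Local Open Scope set_scope.

(* Ideals are classical sets of ring elements: [set R] (membership is a Prop),
   whereas vertex sets are finite sets [{set V}]. *)
Section Ideals.
Variable R : comNzRingType.
Implicit Types (I P Q : set R) (G : set R).

Definition ideal_gen G : set R :=
  [set f | exists n (a g : 'I_n -> R),
     (forall i, G (g i)) /\ f = \sum_(i < n) a i * g i]%classic.

Definition ideal_add I J : set R :=
  [set h | exists2 f, I f & exists2 g, J g & h = f + g]%classic.

Definition ideal_sat I (m : R) : set R :=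
  [set f | exists k : nat, I (f * m ^+ k)]%classic.

(* [idealr_closed] includes properness. *)
Definition prime_ideal P : Prop :=
  idealr_closed (mem P) /\ prime_idealr_closed (mem P).

Definition minimal_prime I P : Prop :=
  [/\ prime_ideal P, (I `<=` P)%classic
    & forall Q, prime_ideal Q -> (I `<=` Q)%classic -> (Q `<=` P)%classic ->
        Q = P].

End Ideals.

(* A simple graph on V is given by its adjacency relation e (symmetric and
   irreflexive in the theorem); all other graphs that occur are induced
   subgraphs, represented by their vertex sets W : {set V}. In particular G is
   represented by [set: V], G_S by ~: S, and a component by its vertex set. *)
Section Graphs.
Variables (V : finType) (e : rel V).
Implicit Types (W S C : {set V}).

Definition induced_rel W : rel V :=
  [rel u v | [&& u \in W, v \in W & e u v]].

Definition components W : {set {set V}} :=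
  equivalence_partition (connect (induced_rel W)) W.

Definition bipartite W : bool :=
  [exists A : {set V}, [forall u in W, forall v in W,
     e u v ==> ((u \in A) != (v \in A))]].

Definition num_comp W : nat := #|components W|.

Definition num_bip_comp W : nat := #|[set C in components W | bipartite C]%SET|.

Definition s_inv W : nat := (num_bip_comp W + num_comp W)%N.

Definition connected_graph : Prop := num_comp [set: V]%SET = 1%N.

Definition disconnector S : Prop :=
  forall s, s \in S -> (s_inv (~: (S :\ s)) < s_inv (~: S))%N.

Definition joined_components S (s : V) : {set {set V}} :=
  [set C in components (~: S) | [exists v in C, e s v]]%SET.

End Graphs.

Section ParityIdeals.
Variables (K : fieldType) (V : finType) (e : rel V).
Implicit Types (W S C : {set V}) (sg : {set V} -> bool).

(* The ring K[x_i, y_i : i in V(G)]. Ideals of the subrings attached to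
   subgraphs are identified with their extensions to this ring. *)
Definition pring := {mpoly K[#|V| + #|V|]}.

Definition xv (i : V) : pring := 'X_(lshift #|V| (enum_rank i)).
Definition yv (i : V) : pring := 'X_(rshift #|V| (enum_rank i)).

Definition parity_ideal W : set pring :=
  ideal_gen [set f | exists i j, [/\ i \in W, j \in W, e i j
                                   & f = xv i * xv j - yv i * yv j]]%classic.

Definition J_ideal W : set pring :=
  ideal_sat (parity_ideal W) (\prod_(i in W) (xv i * yv i)).

Definition m_ideal S : set pring :=
  ideal_gen [set f | exists2 s, s \in S & f = xv s \/ f = yv s]%classic.

(* p^+ for b = true, p^- for b = false *)
Definition p_ideal (b : bool) C : set pring :=
  ideal_gen [set f | exists2 i, i \in C &
                     f = if b then xv i + yv i else xv i - yv i]%classic.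

(* The sum of the J_{B_i} and p^{sigma_i}(N_i) over the components of G_S.
   A sign vector is a function sg on vertex sets, of which only the values at
   the non-bipartite components of G_S matter. *)
Definition signed_prime S sg : set pring :=
  \big[@ideal_add pring/[set 0]%classic]_(C in components e (~: S))
     (if bipartite e C then J_ideal C else p_ideal (sg C) C).

Definition admissible_signs S sg : Prop :=
  2%N \in [pchar K] ->
  forall C, C \in components e (~: S) -> ~~ bipartite e C -> sg C = true.

Definition sign_split_signs S sg : Prop :=
  forall s, s \in S ->
    (forall C, C \in joined_components e S s -> ~~ bipartite e C) ->
    ~ (forall C, C \in joined_components e S s -> sg C = true) /\
    ~ (forall C, C \in joined_components e S s -> sg C = false).

Definition sign_split_minimal_prime S (p : set pring) : Prop :=
  minimal_prime (J_ideal (~: S)) p /\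
  exists sg, [/\ admissible_signs S sg, p = signed_prime S sg
               & sign_split_signs S sg].

End ParityIdeals.

Arguments parity_ideal K {V} e W.
Arguments m_ideal K {V} S.

(* Main.v *)
From HB Require Import structures.
Require Import Defs.
From mathcomp Require Import all_boot all_order all_algebra.
From mathcomp Require Import ring zify.
From mathcomp Require Import boolp classical_sets.
From mathcomp Require Import mpoly fintype finset.

(** For S and a sign vector sg let Q(S,sg) := m_S + signed_prime S sg. Every
    Q(S,sg) is a prime containing I_G, every prime containing I_G contains some
    Q(S,sg), and hence the minimal primes of I_G are the minimal ones among the
    Q(S,sg); what remains is a comparison of these ideals in terms of the graph.

    Primality ([candidate_prime]). Q(S,sg) is the kernel of an endomorphism of the
    polynomial ring, a domain ([candidate_kernel]). The endomorphism kills x_s, y_s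
    for s in S, sends y_i to -+x_i on a non-bipartite component, and on a bipartite
    component with root r, where a 2-colouring renames x_i, y_i to z_i, w_i such
    that an edge ij reads z_i w_j - w_i z_j, it sends z_i to z_r w_i and fixes w_i.
    After the substitutions that the generators of Q(S,sg) allow, a toric map
    remains. Its kernel is spanned by differences of monomials with the same image,
    and two such monomials are linked by exchanges of z_i w_j for w_i z_j
    ([zw_monomial_exchange]), each of which stays in one J_B. Several bipartite
    components are thus treated at once, although a sum of primes need not be prime.

    Existence. Let P be a prime that contains I_G, and S the set of vertices s with
    x_s, y_s both in P. For i, j in one component of G_S, P contains
    x_i y_j - y_i x_j if an even walk joins them, and x_i x_j - y_i y_j if an odd
    one does: along an edge the two alternate, because at every vertex outside S one
    can cancel x or y. In a non-bipartite component both hold for some pair, so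
    x_i^2 - y_i^2 lies in P and P contains x_i + y_i or x_i - y_i, with one sign for
    the whole component ([prime_signs]).

    Comparison. Suppose that s in S, and let M be the component of s after s has
    been returned to G_S. The sign vector can be changed such that Q(S \ s, -) is
    inside Q(S,sg) as soon as either M is bipartite and at most one component of G_S
    is joined to s, or M is not bipartite and all components joined to s are
    non-bipartite with a common sign ([candidate_add_vertex]). One of these cases
    occurs whenever S fails to be a disconnector at s, as one sees by counting
    components ([s_inv_add], [s_inv_not_lt]), or sg fails to be sign-split at s.
    Conversely, if S is a disconnector and sg is sign-split, then a prime P between
    I_G and Q(S,sg) contains x_s, y_s for all s in S ([sign_split_zero_set]):
    otherwise the component D of s for the zero set of P swallows all components
    joined to s, and the binomials or linear forms that P contains on D are in
    Q(S,sg) only if one of the two cases above occurs. Such a P equals Q(S,sg)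
    ([eq_candidate]). *)

Set Implicit Arguments.
Unset Strict Implicit.
Unset Printing Implicit Defensive.

Import GRing.Theory.

Local Open Scope ring_scope.

(** * Ideals as sets of ring elements *)

Section IdealTheory.
Variable R : comNzRingType.
Implicit Types (I J P Q A : set R).

(** Unlike [idealr_closed], this allows the unit ideal. *)
Definition is_ideal I : Prop :=
  I 0 /\ forall a u v, I u -> I v -> I (a * u + v).

Lemma idealM I a u : is_ideal I -> I u -> I (a * u).
Proof. by move=> [I0 Ilin] Iu; rewrite -[a * u]addr0; apply: Ilin. Qed.

Lemma idealD I u v : is_ideal I -> I u -> I v -> I (u + v).
Proof. by move=> [I0 Ilin] Iu Iv; rewrite -[u]mul1r; apply: Ilin. Qed.

Lemma ideal_sum I (T : Type) (r : seq T) (F : T -> R) :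
  is_ideal I -> (forall i, I (F i)) -> I (\sum_(i <- r) F i).
Proof. move=> II IF; apply: (big_ind (fun u => I u)) => // [|u v]; first by case: II.
exact: idealD. Qed.

(** Reduces ideal membership to a ring identity with two explicit coefficients. *)
Lemma ideal_lin I a b u v w :
  is_ideal I -> I u -> I v -> w = a * u + b * v -> I w.
Proof. by move=> II Iu Iv ->; apply: idealD; [| apply: idealM | apply: idealM]. Qed.

Lemma ideal_gen_ideal A : is_ideal (ideal_gen A).
Proof.
split=> [|a u v [n [c [g [Ag ->]]]] [m [d [h [Ah ->]]]]].
  by exists 0%N, (fun=> 0), (fun=> 0); split; [case | rewrite big_ord0].
exists (n + m)%N,
  (fun i => match split i with inl j => a * c j | inr j => d j end),
  (fun i => match split i with inl j => g j | inr j => h j end).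
split=> [i|]; first by case: (split i).
rewrite big_split_ord mulr_sumr; congr (_ + _); apply: eq_bigr => i _ /=.
  by rewrite (unsplitK (inl _ i)) mulrA.
by rewrite (unsplitK (inr _ i)).
Qed.

Lemma mem_ideal_gen A f : A f -> ideal_gen A f.
Proof.
by move=> Af; exists 1%N, (fun=> 1), (fun=> f); rewrite big_ord1 mul1r.
Qed.

Lemma ideal_gen_sub A I : is_ideal I ->
  (forall f, A f -> I f) -> forall f, ideal_gen A f -> I f.
Proof.
by move=> II AI f [n [c [g [Ag ->]]]]; apply: ideal_sum => // i; apply: idealM => //; exact: AI.
Qed.

Lemma ideal_add_ideal I J : is_ideal I -> is_ideal J -> is_ideal (ideal_add I J).
Proof.
move=> II IJ; split=> [|a u v [f If [g Jg ->]] [f' If' [g' Jg' ->]]].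
  by exists 0; [case: II | exists 0; [case: IJ | rewrite addr0]].
exists (a * f + f'); first by case: II => _; apply.
by exists (a * g + g'); [case: IJ => _; apply | ring].
Qed.

Lemma sub_ideal_addl I J f : is_ideal J -> I f -> ideal_add I J f.
Proof. by case=> J0 _ If; exists f => //; exists 0; rewrite ?addr0. Qed.

Lemma sub_ideal_addr I J f : is_ideal I -> J f -> ideal_add I J f.
Proof. by case=> I0 _ Jf; exists 0 => //; exists f; rewrite ?add0r. Qed.

Lemma ideal_sat_ideal I m : is_ideal I -> is_ideal (ideal_sat I m).
Proof.
move=> II; split=> [|a u v [k Iu] [l Iv]]; first by exists 0%N; rewrite mul0r; case: II.
exists (k + l)%N; rewrite exprD.
by apply: (ideal_lin (a := a * m ^+ l) (b := m ^+ k) II Iu Iv); ring.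
Qed.

Lemma sub_ideal_sat I m f : I f -> ideal_sat I m f.
Proof. by move=> If; exists 0%N; rewrite mulr1. Qed.

(** A factor of m can be cancelled modulo the saturation at m, since the missing
    cofactor can be multiplied in. *)
Lemma ideal_sat_cancel I m c d f :
  is_ideal I -> m = c * d -> ideal_sat I m (c * f) -> ideal_sat I m f.
Proof.
move=> II mE [k If]; exists k.+1.
by rewrite exprS {1}mE; apply: (ideal_lin (a := d) (b := 0) II If If); ring.
Qed.

Lemma big_ideal_add_ideal (T : Type) (r : seq T) (p : pred T) (F : T -> set R) :
    (forall t, is_ideal (F t)) ->
  is_ideal (\big[@ideal_add R/[set 0]%classic]_(t <- r | p t) F t).
Proof.
move=> FI; apply: (big_ind (fun I => is_ideal I)) => // [|I J]; last exact: ideal_add_ideal.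
by split=> // a u v /= -> ->; rewrite mulr0 addr0.
Qed.

Lemma big_ideal_add_sub (T : eqType) (r : seq T) (p : pred T) (F : T -> set R) I :
    is_ideal I ->
    (forall t, t \in r -> p t -> forall f, F t f -> I f) ->
  forall f, (\big[@ideal_add R/[set 0]%classic]_(t <- r | p t) F t) f -> I f.
Proof.
move=> II FsubI; rewrite big_seq_cond.
apply: (big_ind (fun A : set R => forall f, A f -> I f)) =>
  [f -> | A B AI BI f [u Au [v Bv ->]] |t /andP[]].
- by case: II.
- by apply: idealD; [| apply: AI | apply: BI].
- exact: FsubI.
Qed.

Lemma sub_big_ideal_add (T : eqType) (r : seq T) (p : pred T) (F : T -> set R) t f :
    (forall t, is_ideal (F t)) -> t \in r -> p t -> F t f ->
  (\big[@ideal_add R/[set 0]%classic]_(t <- r | p t) F t) f.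
Proof.
move=> FI; elim: r => // t' r IHr; rewrite inE big_cons.
case: eqP => [<- _ -> | _ /= tr pt] Ftf.
  by apply: sub_ideal_addl => //; apply: big_ideal_add_ideal.
have {}IHr := IHr tr pt Ftf.
by case: (p t') => //; apply: sub_ideal_addr.
Qed.

Lemma prime_idealP P :
  prime_ideal P <-> [/\ is_ideal P, ~ P 1 & forall u v, P (u * v) -> P u \/ P v].
Proof.
split=> [[[P0 P1 Plin] PM] | [[P0 Plin] P1 PM]].
  split=> [||u v Puv].
  - split=> [|a u v Pu Pv]; first by move: P0; rewrite in_setE.
    by have := Plin a u v; rewrite !in_setE; apply.
  - by move=> P1'; move/negP: P1; apply; rewrite in_setE.
  - have := PM u v; rewrite !in_setE => /(_ Puv) /orP[] /asboolP; by [left | right].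
split; [split|].
- by rewrite in_setE.
- by apply/negP; rewrite in_setE.
- by move=> a u v; rewrite !in_setE; apply: Plin.
- move=> u v; rewrite !in_setE => /PM[] Pu; apply/orP; [left|right]; exact/asboolP.
Qed.

End IdealTheory.

Lemma kernel_prime (A : comNzRingType) (B : idomainType) (f : {rmorphism A -> B}) :
  prime_ideal [set a | f a = 0]%classic.
Proof.
apply/prime_idealP; split=> /= [|/eqP|u v].
- by split=> [|a u v /= fu fv]; rewrite /= ?rmorph0 // rmorphD rmorphM fu fv mulr0 addr0.
- by rewrite rmorph1 oner_eq0.
- by rewrite rmorphM => /eqP; rewrite mulf_eq0 => /orP[] /eqP; [left | right].
Qed.

(** * Kernels of monomial maps *)

Lemma mpolyX_neq0 (K : fieldType) n (m : 'X_{1..n}) : 'X_[m] != 0 :> {mpoly K[n]}.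
Proof. by rewrite -msupp_eq0 msuppX. Qed.

Section MonomialMap.
Variables (K : fieldType) (n : nat) (g : 'I_n -> 'X_{1..n}).
Implicit Types (f : {mpoly K[n]}) (m : 'X_{1..n}).

Definition monomial_map : {mpoly K[n]} -> {mpoly K[n]} :=
  comp_mpoly [tuple 'X_[g k] | k < n].

HB.instance Definition _ := GRing.RMorphism.on monomial_map.

Definition image_exponent m : 'X_{1..n} := (\sum_(k < n) g k *+ m k)%MM.

Lemma monomial_mapX m : monomial_map 'X_[m] = 'X_[image_exponent m].
Proof.
rewrite /monomial_map comp_mpolyX -mprodXnE.
by apply: eq_bigr => k _; rewrite tnth_mktuple.
Qed.

Lemma monomial_mapZ c f : monomial_map (c *: f) = c *: monomial_map f.
Proof. exact: comp_mpolyZ. Qed.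

Lemma image_exponentE m l : image_exponent m l = (\sum_(k < n) g k l * m k)%N.
Proof. by rewrite mnm_sumE; apply: eq_bigr => k _; rewrite mulmnE. Qed.

(** A polynomial f in the kernel has no monomial whose image is isolated: the
    coefficient of that image would not vanish. So f has two monomials with the same
    image, and subtracting a multiple of their difference, which lies in Q, removes
    one of them from the support. *)
Lemma monomial_map_kernel (Q : set {mpoly K[n]}) : is_ideal Q ->
    (forall m m', image_exponent m = image_exponent m' -> Q ('X_[m] - 'X_[m'])) ->
  forall f, monomial_map f = 0 -> Q f.
Proof.
move=> QI Qbin f; have [d] := ubnP (size (msupp f)); elim: d f => // d IHd f.
rewrite ltnS => szf muf.
have [->|f0] := eqVneq f 0; first by case: QI.
have [m mf] : exists m, m \in msupp f.
  case E: (msupp f) => [|m s]; last by exists m; rewrite mem_head.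
  by move: f0; rewrite -msupp_eq0 E.
have [m' [m'f m'm gmm']] :
    exists m', [/\ m' \in msupp f, m' != m & image_exponent m' = image_exponent m].
  apply: contrapT => no.
  have : (monomial_map f)@_(image_exponent m) = f@_m.
    rewrite {1}[f]mpolyE rmorph_sum raddf_sum (bigD1_seq m) //=.
    rewrite monomial_mapZ monomial_mapX mcoeffZ mcoeffX eqxx mulr1.
    rewrite big_seq_cond big1 ?addr0 // => m' /andP[m'f m'm].
    rewrite monomial_mapZ monomial_mapX mcoeffZ mcoeffX; case: eqP => [E|_]; last by rewrite mulr0.
    by case: no; exists m'.
  by rewrite muf mcoeff0 => /esym/eqP; rewrite mcoeff_eq0 mf.
pose h := f - f@_m *: ('X_[m] - 'X_[m']).
have Qh : Q h.
  apply: IHd; last first.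
    by rewrite /h rmorphB /= monomial_mapZ rmorphB /= !monomial_mapX gmm' muf subrr scaler0 subrr.
  apply: leq_trans szf; apply: (@uniq_leq_size _ (m :: msupp h)).
    rewrite /= msupp_uniq andbT -mcoeff_eq0 /h mcoeffB mcoeffZ mcoeffB !mcoeffX eqxx.
    by rewrite (negPf m'm) subr0 mulr1 subrr.
  move=> k; rewrite inE => /predU1P[-> //|]; rewrite !mcoeff_msupp; apply: contraNN.
  rewrite /h mcoeffB mcoeffZ mcoeffB !mcoeffX => /eqP fk.
  have [E|_] := eqVneq m k; first by move: mf; rewrite E mcoeff_msupp fk eqxx.
  have [E|_] := eqVneq m' k; first by move: m'f; rewrite E mcoeff_msupp fk eqxx.
  by rewrite fk subrr mulr0 subr0.
have -> : f = h + (f@_m)%:MP * ('X_[m] - 'X_[m']) by rewrite mul_mpolyC subrK.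
by apply: idealD => //; apply: idealM => //; apply: Qbin; rewrite gmm'.
Qed.

End MonomialMap.

(** * Substitutions in K[x_i, y_i] *)

Section VariableIndices.
Variable V : finType.
Implicit Types (i j : V).

Definition x_index i : 'I_(#|V| + #|V|) := lshift #|V| (enum_rank i).
Definition y_index i : 'I_(#|V| + #|V|) := rshift #|V| (enum_rank i).

(** A function on the variables is given by its values on the x_i and on the y_i. *)
Definition on_indices T (hx hy : V -> T) (k : 'I_(#|V| + #|V|)) : T :=
  match split k with inl a => hx (enum_val a) | inr a => hy (enum_val a) end.

Lemma on_indicesx T (hx hy : V -> T) i : on_indices hx hy (x_index i) = hx i.
Proof. by rewrite /on_indices (unsplitK (inl _ _)) enum_rankK. Qed.

Lemma on_indicesy T (hx hy : V -> T) i : on_indices hx hy (y_index i) = hy i.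
Proof. by rewrite /on_indices (unsplitK (inr _ _)) enum_rankK. Qed.

Variant index_spec : 'I_(#|V| + #|V|) -> Type :=
  | IndexX i : index_spec (x_index i)
  | IndexY i : index_spec (y_index i).

Lemma indexP k : index_spec k.
Proof.
rewrite -[k]splitK; case: (split k) => a /=; rewrite -(enum_valK a).
  exact: IndexX.
exact: IndexY.
Qed.

Lemma x_index_inj : injective x_index.
Proof. by move=> i j /lshift_inj/enum_rank_inj. Qed.

Lemma y_index_inj : injective y_index.
Proof. by move=> i j /rshift_inj/enum_rank_inj. Qed.

Lemma xy_index i j : (x_index i == y_index j) = false.
Proof. exact: eq_lrshift. Qed.

(** A 2-colouring [side] renames the pair x_i, y_i to z_i, w_i, in this order on one
    colour class and in the opposite order on the other: both kinds of binomials
    x_i x_j - y_i y_j and x_i y_j - y_i x_j then become 2x2-minors of the matrix with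
    rows z and w. *)
Variable side : V -> bool.

Definition z_index i := if side i then x_index i else y_index i.
Definition w_index i := if side i then y_index i else x_index i.

Lemma z_index_eq i j : (z_index i == z_index j) = (i == j).
Proof.
apply/eqP/eqP=> [|-> //]; rewrite /z_index.
case: (side i); case: (side j); first [exact: x_index_inj | exact: y_index_inj | idtac].
  by move/eqP; rewrite xy_index.
by move/esym/eqP; rewrite xy_index.
Qed.

Lemma w_index_eq i j : (w_index i == w_index j) = (i == j).
Proof.
apply/eqP/eqP=> [|-> //]; rewrite /w_index.
case: (side i); case: (side j); first [exact: x_index_inj | exact: y_index_inj | idtac].
  by move/esym/eqP; rewrite xy_index.
by move/eqP; rewrite xy_index.
Qed.

Lemma zw_index i j : (z_index i == w_index j) = false.
Proof.
rewrite /z_index /w_index; have [<-|ij] := eqVneq i j.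
  by case: (side i); rewrite ?xy_index // eq_sym xy_index.
by case: (side i); case: (side j); rewrite ?(inj_eq x_index_inj) ?(inj_eq y_index_inj)
  ?(negPf ij) ?xy_index // eq_sym xy_index.
Qed.

Lemma big_zw_index T (idx : T) (op : Monoid.com_law idx) (F : 'I_(#|V| + #|V|) -> T) :
  \big[op/idx]_k F k =
    op (\big[op/idx]_i F (z_index i)) (\big[op/idx]_i F (w_index i)).
Proof.
rewrite big_split_ord /= (reindex (@enum_rank V)) /=; last exact/onW_bij/enum_rank_bij.
rewrite [X in op _ X](reindex (@enum_rank V)) /=; last exact/onW_bij/enum_rank_bij.
rewrite -!big_split /=; apply: eq_bigr => i _; rewrite /z_index /w_index.
by case: (side i) => //; rewrite Monoid.mulmC.
Qed.

End VariableIndices.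

Section Substitution.
Variables (K : fieldType) (V : finType).
Local Notation R := (pring K V).
Local Notation xv := (@xv K V).
Local Notation yv := (@yv K V).

Definition subst (hx hy : V -> R) : R -> R :=
  comp_mpoly [tuple on_indices hx hy k | k < #|V| + #|V|].

HB.instance Definition _ hx hy := GRing.RMorphism.on (subst hx hy).

Lemma substx hx hy i : subst hx hy (xv i) = hx i.
Proof. by rewrite /subst /xv comp_mpolyXU -tnth_nth tnth_mktuple on_indicesx. Qed.

Lemma substy hx hy i : subst hx hy (yv i) = hy i.
Proof. by rewrite /subst /yv comp_mpolyXU -tnth_nth tnth_mktuple on_indicesy. Qed.

Lemma substC hx hy (c : K) : subst hx hy c%:MP = c%:MP.
Proof. exact: comp_mpolyC. Qed.

(** Modulo Q the substitution fixes each variable, so it induces the identity of the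
    quotient ring. *)
Lemma subst_congr (Q : set R) hx hy : is_ideal Q ->
    (forall i, Q (xv i - hx i)) -> (forall i, Q (yv i - hy i)) ->
  forall f, Q (f - subst hx hy f).
Proof.
move=> QI Qx Qy; have [Q0 _] := QI.
have QM u v : Q (u - subst hx hy u) -> Q (v - subst hx hy v) ->
    Q (u * v - subst hx hy (u * v)).
  by move=> Qu Qv; apply: (ideal_lin (a := v) (b := subst hx hy u) QI Qu Qv); rewrite rmorphM; ring.
elim/mpolyind => [|c m p _ _ Qp]; first by rewrite rmorph0 subrr.
suff QX : Q ('X_[m] - subst hx hy 'X_[m]).
  apply: (ideal_lin (a := c%:MP) (b := 1) QI QX Qp).
  by rewrite rmorphD /= -mul_mpolyC rmorphM /= substC; ring.
rewrite mpolyXE_id; apply: (big_ind (fun u => Q (u - subst hx hy u))) => //.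
  by rewrite rmorph1 subrr.
move=> k _; elim: (m k) => [|d IHd]; first by rewrite expr0 rmorph1 subrr.
rewrite exprS; apply: QM => //.
by case: (indexP k) => i; [have := Qx i | have := Qy i]; rewrite -?(substx hx hy) -?(substy hx hy).
Qed.

End Substitution.

(** * The toric map of a family of determinantal ideals *)

Section Toric.
Variables (K : fieldType) (V : finType) (side : V -> bool) (rho : V -> V).
Local Notation R := (pring K V).
Local Notation xv := (@xv K V).
Local Notation yv := (@yv K V).
Local Notation zi := (z_index side).
Local Notation wi := (w_index side).

Definition zv i := if side i then xv i else yv i.
Definition wv i := if side i then yv i else xv i.

Lemma zvE i : zv i = 'X_(zi i).
Proof. by rewrite /zv /z_index; case: (side i). Qed.

Lemma wvE i : wv i = 'X_(wi i).
Proof. by rewrite /wv /w_index; case: (side i). Qed.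

(** The map z_i |-> z_(rho i) w_i, w_i |-> w_i. On a fibre of rho the matrix with rows
    z and w becomes a matrix of rank one, so the minors on each fibre vanish; on a
    fibre with one element the map is injective. *)
Definition toric_exponent : 'I_(#|V| + #|V|) -> 'X_{1..(#|V| + #|V|)} :=
  on_indices
    (fun i => if side i then (U_(zi (rho i)) + U_(wi i))%MM else U_(wi i)%MM)
    (fun i => if side i then U_(wi i)%MM else (U_(zi (rho i)) + U_(wi i))%MM).

Lemma toric_exponentz i : toric_exponent (zi i) = (U_(zi (rho i)) + U_(wi i))%MM.
Proof.
case E: (side i).
  have -> : zi i = x_index i by rewrite /z_index E.
  by rewrite /toric_exponent on_indicesx E.
have -> : zi i = y_index i by rewrite /z_index E.
by rewrite /toric_exponent on_indicesy E.
Qed.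

Lemma toric_exponentw i : toric_exponent (wi i) = U_(wi i)%MM.
Proof.
case E: (side i).
  have -> : wi i = y_index i by rewrite /w_index E.
  by rewrite /toric_exponent on_indicesy E /w_index E.
have -> : wi i = x_index i by rewrite /w_index E.
by rewrite /toric_exponent on_indicesx E /w_index E.
Qed.

Definition toric : R -> R := monomial_map toric_exponent.

HB.instance Definition _ := GRing.RMorphism.on toric.

Lemma toric_X k : toric 'X_k = 'X_[toric_exponent k].
Proof. by rewrite /toric /monomial_map comp_mpolyXU -tnth_nth tnth_mktuple. Qed.

Lemma toric_z i : toric (zv i) = zv (rho i) * wv i.
Proof. by rewrite zvE toric_X toric_exponentz mpolyXD !zvE !wvE. Qed.

Lemma toric_w i : toric (wv i) = wv i.
Proof. by rewrite wvE toric_X toric_exponentw. Qed.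

Lemma image_exponentw m i :
  image_exponent toric_exponent m (wi i) = (m (zi i) + m (wi i))%N.
Proof.
rewrite image_exponentE (big_zw_index side); congr addn.
  rewrite (bigD1 i) //= toric_exponentz mnmDE !mnm1E zw_index eqxx mul1n.
  rewrite big1 ?addn0 // => j ji.
  by rewrite toric_exponentz mnmDE !mnm1E zw_index w_index_eq (negPf ji).
rewrite (bigD1 i) //= toric_exponentw mnm1E eqxx mul1n.
rewrite big1 ?addn0 // => j ji.
by rewrite toric_exponentw mnm1E w_index_eq (negPf ji).
Qed.

Lemma image_exponentz m r :
  image_exponent toric_exponent m (zi r) = (\sum_(i | rho i == r) m (zi i))%N.
Proof.
rewrite image_exponentE (big_zw_index side) -[RHS]addn0; congr addn.
  rewrite [RHS]big_mkcond; apply: eq_bigr => i _.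
  rewrite toric_exponentz mnmDE !mnm1E [wi _ == _]eq_sym zw_index addn0 z_index_eq.
  by case: (_ == r); rewrite ?mul1n.
by rewrite big1 // => i _; rewrite toric_exponentw mnm1E eq_sym zw_index.
Qed.

Definition zw_monomial (a b : V -> nat) : R :=
  (\prod_i zv i ^+ a i) * (\prod_i wv i ^+ b i).

Lemma zw_monomialE (m : 'X_{1..(#|V| + #|V|)}) :
  'X_[m] = zw_monomial (fun i => m (zi i)) (fun i => m (wi i)).
Proof.
rewrite mpolyXE_id (big_zw_index side) /zw_monomial.
by congr (_ * _); apply: eq_bigr => i _; rewrite (zvE, wvE).
Qed.

Lemma eq_zw_monomial a b a' b' : a =1 a' -> b =1 b' ->
  zw_monomial a b = zw_monomial a' b'.
Proof.
by move=> aE bE; congr (_ * _); apply: eq_bigr => i _; rewrite (aE, bE).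
Qed.

Lemma zw_monomialDz a b i :
  zw_monomial (fun l => (l == i) + a l)%N b = zv i * zw_monomial a b.
Proof.
rewrite /zw_monomial mulrA; congr (_ * _).
rewrite (bigD1 i) //= eqxx exprS -mulrA [in RHS](bigD1 i) //=; congr (_ * (_ * _)).
by apply: eq_bigr => l /negPf ->.
Qed.

Lemma zw_monomialDw a b i :
  zw_monomial a (fun l => (l == i) + b l)%N = wv i * zw_monomial a b.
Proof.
rewrite /zw_monomial mulrCA; congr (_ * _).
rewrite (bigD1 i) //= eqxx exprS -mulrA [in RHS](bigD1 i) //=; congr (_ * (_ * _)).
by apply: eq_bigr => l /negPf ->.
Qed.

Lemma sum_class_ltn (a a' : V -> nat) (p : pred V) i : p i ->
    (forall j, p j -> a j <= a' j)%N -> (a i < a' i)%N ->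
  (\sum_(j | p j) a j < \sum_(j | p j) a' j)%N.
Proof.
move=> pi le_a lt_i; rewrite (bigD1 i) //= [X in (_ < X)%N](bigD1 i) //= -addSn.
by apply: leq_add => //; apply: leq_sum => j /andP[/le_a].
Qed.

(** The 2x2-minors on the fibres of rho link all monomials with the same image.
    If a i exceeds a' i, then, the sums over the fibre of i being equal, a j is less
    than a' j for some j in this fibre, and w_j divides the first monomial because
    a j + b j = a' j + b' j. Replacing z_i w_j by w_i z_j brings a closer to a'. *)
Lemma zw_monomial_exchange (Q : set R) a b a' b' : is_ideal Q ->
    (forall i j, rho i = rho j -> Q (zv i * wv j - wv i * zv j)) ->
    (forall i, a i + b i = a' i + b' i)%N ->
    (forall r, \sum_(i | rho i == r) a i = \sum_(i | rho i == r) a' i)%N ->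
  Q (zw_monomial a b - zw_monomial a' b').
Proof.
move=> QI Qminor; have [d] := ubnP (\sum_i (a i - a' i)).
elim: d a b => // d IHd a b; rewrite ltnS => sz_a eq_ab eq_a.
case: (pickP [pred i | a' i < a i]%N) => [i /= lt_i | le_all]; last first.
  have le_a l : (a l <= a' l)%N by rewrite leqNgt; have /= -> := le_all l.
  have aE l : a l = a' l.
    apply/eqP; rewrite eqn_leq le_a leqNgt /=; apply/negP => lt_l.
    have := @sum_class_ltn a a' [pred j | rho j == rho l] l (eqxx _) (fun j _ => le_a j) lt_l.
    by rewrite eq_a ltnn.
  rewrite (eq_zw_monomial (a' := a') (b' := b')) ?subrr; first by case: QI.
    exact: aE.
  by move=> l; have := eq_ab l; rewrite aE => /addnI.
have [j /eqP rho_ji lt_j] : exists2 j, rho j == rho i & (a j < a' j)%N.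
  apply: contrapT => no.
  have : (\sum_(j | rho j == rho i) a' j < \sum_(j | rho j == rho i) a j)%N.
    apply: (@sum_class_ltn a' a [pred j | rho j == rho i] i) => //= j rho_j.
    by rewrite leqNgt; apply/negP => lt_j; apply: no; exists j.
  by rewrite eq_a ltnn.
have ij : i != j by apply: contraTneq lt_j => <-; rewrite -leqNgt ltnW.
have b_j : (0 < b j)%N by have := eq_ab j; lia.
(* the exponents that remain after z_i w_j has been split off *)
pose c l := (a l - (l == i))%N; pose e l := (b l - (l == j))%N.
have aE : a =1 (fun l => (l == i) + c l)%N.
  by rewrite /c => l; have [->|_] := eqVneq l i; lia.
have bE : b =1 (fun l => (l == j) + e l)%N.
  by rewrite /e => l; have [->|_] := eqVneq l j; lia.
pose a1 l := ((l == j) + c l)%N; pose b1 l := ((l == i) + e l)%N.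
have a1E l : ((l == i) + a1 l = (l == j) + a l)%N by rewrite aE addnCA.
have Q1 : Q (zw_monomial a1 b1 - zw_monomial a' b').
  apply: IHd => [|l|r].
  - apply: leq_trans sz_a; apply: (@sum_class_ltn _ _ predT i) => // [l _|].
      by have := a1E l; have [->|_] := eqVneq l j; lia.
    by have := a1E i; rewrite eqxx (negPf ij); lia.
  - by have := a1E l; have := eq_ab l; have := bE l; rewrite /b1; lia.
  - have classE k : (\sum_(l | rho l == r) (l == k) = (rho k == r))%N.
      have [rho_k|ne] := eqVneq (rho k) r.
        rewrite (bigD1 k) ?rho_k //= eqxx big1 // => l /andP[_ /negPf -> //].
      by rewrite big1 // => l /eqP rho_l; case: eqP => // lk; case/eqP: ne; rewrite -lk.
    rewrite -eq_a; apply/eqP; rewrite -(eqn_add2l (rho i == r)) -{1}classE -rho_ji -classE.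
    by rewrite -!big_split /=; apply/eqP/eq_bigr => l _; exact: a1E.
have -> : zw_monomial a b - zw_monomial a' b' =
    zw_monomial c e * (zv i * wv j - wv i * zv j) + (zw_monomial a1 b1 - zw_monomial a' b').
  rewrite (eq_zw_monomial aE bE) /a1 /b1 !zw_monomialDz !zw_monomialDw; ring.
by apply: idealD => //; apply: idealM => //; apply: Qminor.
Qed.

Lemma toric_kernel (Q : set R) : is_ideal Q ->
    (forall i j, rho i = rho j -> Q (zv i * wv j - wv i * zv j)) ->
  forall f, toric f = 0 -> Q f.
Proof.
move=> QI Qminor; apply: monomial_map_kernel => // m m' gmm'.
rewrite !zw_monomialE; apply: zw_monomial_exchange => // [i|r];
  rewrite -?image_exponentw -?image_exponentz.
  by rewrite gmm'.
by rewrite gmm'.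
Qed.

End Toric.

(** * Components of induced subgraphs *)

Section Components.
Variables (V : finType) (e : rel V).
Hypothesis e_sym : ssrbool.symmetric e.
Implicit Types (W S C D M : {set V}) (i j k s : V).

Definition component_at W i : {set V} := [set j in W | connect (induced_rel e W) i j].

Lemma componentsP W C :
  reflect (exists2 i, i \in W & C = component_at W i) (C \in components e W).
Proof. exact: imsetP. Qed.

Lemma induced_connect_sym W : connect_sym (induced_rel e W).
Proof.
apply: sym_connect_sym => i j /=.
by rewrite /induced_rel /= e_sym andbCA.
Qed.

Lemma comp_refl W i : i \in W -> i \in component_at W i.
Proof. by move=> iW; rewrite inE iW connect0. Qed.

Lemma comp_components W i : i \in W -> component_at W i \in components e W.
Proof. by move=> iW; apply/componentsP; exists i. Qed.

Lemma comp_sub W i : component_at W i \subset W.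
Proof. by apply/subsetP => j; rewrite inE => /andP[]. Qed.

Lemma comp_eq W i j : j \in component_at W i -> component_at W j = component_at W i.
Proof.
rewrite inE => /andP[jW ij]; apply/setP => k; rewrite !inE.
by rewrite (same_connect (@induced_connect_sym W) ij).
Qed.

Lemma component_sub W C : C \in components e W -> C \subset W.
Proof. by case/componentsP => i _ ->; exact: comp_sub. Qed.

Lemma component_eq W C i : C \in components e W -> i \in C -> C = component_at W i.
Proof. by case/componentsP => j _ -> /comp_eq. Qed.

Lemma component_edge W C i j : C \in components e W ->
  i \in C -> j \in W -> e i j -> j \in C.
Proof.
move=> CW iC jW eij; have iW := subsetP (component_sub CW) _ iC.
rewrite (component_eq CW iC) inE jW /=; apply: connect1.
by rewrite /induced_rel /= iW jW.
Qed.

(** Induction along the paths that start at i. *)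
Lemma comp_ind W i (P : V -> Prop) : i \in W -> P i ->
    (forall j k, j \in component_at W i -> k \in component_at W i -> e j k -> P j -> P k) ->
  forall j, j \in component_at W i -> P j.
Proof.
move=> iW Pi Pstep j; rewrite inE => /andP[_ /connectP[p + ->]].
suff walk l : P l -> l \in component_at W i -> path (induced_rel e W) l p -> P (last l p).
  exact/walk/comp_refl.
elim: p l => // k p IHp l Pl lC /= /andP[/and3P[lW kW elk]].
have kC : k \in component_at W i := component_edge (comp_components iW) lC kW elk.
by apply: IHp => //; apply: Pstep Pl.
Qed.

Lemma comp_sub_closed W i D : i \in W -> i \in D ->
    (forall j k, j \in D -> j \in W -> k \in W -> e j k -> k \in D) ->
  component_at W i \subset D.
Proof.
move=> iW iD closedD; apply/subsetP; apply: comp_ind => // j k jC kC ejk jD.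
by apply: closedD ejk => //; exact: (subsetP (comp_sub W i)).
Qed.

Lemma comp_mono W W' i : i \in W -> W \subset W' -> component_at W i \subset component_at W' i.
Proof.
move=> iW sWW'; have iW' := subsetP sWW' _ iW; apply: comp_sub_closed => //.
  exact: comp_refl.
move=> j k jC _ kW; apply: component_edge (comp_components iW') jC _.
exact: (subsetP sWW').
Qed.

Lemma bipartiteP W :
  reflect (exists A : {set V}, forall i j, i \in W -> j \in W -> e i j ->
             (i \in A) != (j \in A)) (bipartite e W).
Proof.
apply: (iffP existsP) => -[A HA]; exists A.
  by move=> i j iW jW; move/forall_inP/(_ i iW)/forall_inP/(_ j jW)/implyP: HA.
apply/forall_inP => i iW; apply/forall_inP => j jW; apply/implyP; exact: HA.
Qed.

Lemma bipartiteS C D : C \subset D -> bipartite e D -> bipartite e C.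
Proof.
move=> /subsetP sCD /bipartiteP[A HA]; apply/bipartiteP; exists A => i j iC jC.
by apply: HA; apply: sCD.
Qed.

Definition bip_vertex W i := (i \in W) && bipartite e (component_at W i).

(** Each bipartite component has a 2-colouring of its own; the parametrization below
    needs them glued to one function on the vertices. *)
Lemma exists_colouring W : exists side : V -> bool,
  forall i j, bip_vertex W i -> j \in W -> e i j -> side i != side j.
Proof.
have /choice[A HA] C : exists A : {set V}, bipartite e C ->
    forall i j, i \in C -> j \in C -> e i j -> (i \in A) != (j \in A).
  have [/bipartiteP[A HA]|_] := boolP (bipartite e C); first by exists A.
  by exists set0.
exists (fun i => i \in A (component_at W i)) => i j /andP[iW bipi] jW eij.
have iC := comp_refl iW.
have jC : j \in component_at W i := component_edge (comp_components iW) iC jW eij.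
by rewrite (comp_eq jC); apply: HA.
Qed.

(** The fibres of [bip_root W] are the bipartite components of W and single vertices
    elsewhere, so that a toric map with this choice of rho leaves the remaining
    variables independent. *)
Definition bip_root W i : V :=
  if bip_vertex W i then fingraph.root (induced_rel e W) i else i.

Lemma bip_vertex_comp W i j : j \in component_at W i -> bip_vertex W i -> bip_vertex W j.
Proof.
move=> jC /andP[_ bipi]; rewrite /bip_vertex (comp_eq jC) bipi andbT.
exact: (subsetP (comp_sub W i)).
Qed.

Lemma bip_root_comp W i j : bip_vertex W i -> j \in component_at W i ->
  bip_root W i = bip_root W j.
Proof.
move=> bipi jC; rewrite /bip_root bipi (bip_vertex_comp jC bipi).
apply/eqP; rewrite root_connect; last exact: induced_connect_sym.
by move: jC; rewrite inE => /andP[].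
Qed.

Lemma bip_rootP W i j : bip_root W i = bip_root W j ->
  i = j \/ bip_vertex W i /\ j \in component_at W i.
Proof.
have root_in k : k \in W -> fingraph.root (induced_rel e W) k \in component_at W k.
  move=> kW; have := @connect_root _ (induced_rel e W) k => kr.
  rewrite inE kr andbT; case/connectP: kr => p; case/lastP: p => [_ -> //|p l].
  by rewrite rcons_path last_rcons => /andP[_ /and3P[_ lW _]] ->.
rewrite /bip_root; case: ifP => bi; case: ifP => bj.
- move/andP: (bj) => [jW _]; move/eqP; rewrite root_connect; last exact: induced_connect_sym.
  by move=> ij; right; rewrite inE jW.
- move=> E; case/andP: (bi) => /root_in; rewrite E => jC _.
  by rewrite (bip_vertex_comp jC bi) in bj.
- move=> E; case/andP: (bj) => /root_in; rewrite -E => iC _.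
  by rewrite (bip_vertex_comp iC bj) in bi.
- by left.
Qed.

Lemma bip_vertex_component W C i :
  C \in components e W -> i \in C -> bip_vertex W i = bipartite e C.
Proof.
move=> CW iC; rewrite /bip_vertex -(component_eq CW iC).
by rewrite (subsetP (component_sub CW)).
Qed.

(** * Returning a deleted vertex to the graph *)

Lemma s_invE W : s_inv e W = (\sum_(C in components e W) (1 + bipartite e C))%N.
Proof.
rewrite /s_inv /num_comp /num_bip_comp big_split /= sum1_card addnC; congr addn.
rewrite -sum1_card big_mkcond [RHS]big_mkcond /=; apply: eq_bigr => C _.
by rewrite inE; case: (_ \in _); case: (bipartite e C).
Qed.

Section AddVertex.
Variables (S : {set V}) (s : V).
Hypothesis sS : s \in S.
Local Notation W := (~: S).
Local Notation W' := (~: (S :\ s)).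
Local Notation joined := (joined_components e S s).

Definition merged_component := component_at W' s.
Local Notation M := merged_component.

Lemma mem_addW i : (i \in W') = (i == s) || (i \in W).
Proof. by rewrite !inE negb_and negbK. Qed.

Lemma subW : W \subset W'.
Proof. by apply/subsetP => i iW; rewrite mem_addW iW orbT. Qed.

Lemma s_addW : s \in W'.
Proof. by rewrite mem_addW eqxx. Qed.

Lemma s_notinW : s \notin W.
Proof. by rewrite inE sS. Qed.

Lemma joinedP C :
  reflect (C \in components e W /\ exists2 v, v \in C & e s v) (C \in joined).
Proof.
rewrite inE; apply: (iffP andP) => -[CW].
  by case/existsP => v /andP[vC esv]; split=> //; exists v.
by case=> v vC esv; split=> //; apply/existsP; exists v; rewrite vC.
Qed.

Lemma joined_sub C : C \in joined -> C \subset M.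
Proof.
case/joinedP => CW [v vC esv]; have vW := subsetP (component_sub CW) _ vC.
have vM : v \in M.
  apply: component_edge esv; [exact/comp_components/s_addW | exact/comp_refl/s_addW |].
  exact: (subsetP subW).
by rewrite (component_eq CW vC) /M -(comp_eq vM); apply: comp_mono subW.
Qed.

(** A component that is not joined to s remains closed under adjacency when s
    returns. *)
Lemma not_joined_component C i : C \in components e W -> C \notin joined ->
  i \in C -> C = component_at W' i.
Proof.
move=> CW CJ iC; have iW := subsetP (component_sub CW) _ iC.
apply/eqP; rewrite eqEsubset {1}(component_eq CW iC) comp_mono ?subW //=.
apply: comp_sub_closed => // [|j k jC _]; first exact: (subsetP subW).
rewrite mem_addW => /predU1P[->|kW] ejk; last exact: component_edge CW jC kW ejk.
by case/joinedP: CJ; split=> //; exists j; rewrite // e_sym.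
Qed.

Lemma mem_merged i : i \in W -> i \in M -> component_at W i \in joined.
Proof.
move=> iW iM; apply: contraT => nJ.
have E := not_joined_component (comp_components iW) nJ (comp_refl iW).
have : s \in component_at W i by rewrite E (comp_eq iM); exact/comp_refl/s_addW.
by move/(subsetP (comp_sub _ _)); rewrite (negPf s_notinW).
Qed.

Lemma components_addE : components e W' = M |: (components e W :\: joined).
Proof.
apply/setP => C; rewrite in_setU1 in_setD; apply/idP/orP => [CW'|].
  have [sC|sC] := boolP (s \in C); first by left; rewrite (component_eq CW' sC).
  right; case/componentsP: (CW') => i; rewrite mem_addW => /predU1P[->|iW] CE.
    by case/negP: sC; rewrite CE; exact/comp_refl/s_addW.
  have nJ : component_at W i \notin joined.
    apply: contra sC => iJ; rewrite CE; have := subsetP (joined_sub iJ) i (comp_refl iW).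
    by move/comp_eq => ->; exact/comp_refl/s_addW.
  have E := not_joined_component (comp_components iW) nJ (comp_refl iW).
  have CE' : C = component_at W i by rewrite CE E.
  by rewrite CE' nJ comp_components.
case=> [/eqP -> | /andP[nJ CW]]; first exact/comp_components/s_addW.
case/componentsP: (CW) => i iW CE; have iC : i \in C by rewrite CE comp_refl.
rewrite (not_joined_component CW nJ iC).
by apply: comp_components; apply: (subsetP subW).
Qed.

(** The components joined to s are merged to M, the others persist; the subtraction
    is avoided by moving terms to the other side. *)
Lemma s_inv_add :
  (s_inv e W' + \sum_(C in joined) (1 + bipartite e C) =
   s_inv e W + (1 + bipartite e M))%N.
Proof.
rewrite !s_invE components_addE big_setU1 /=; last first.
  rewrite in_setD negb_and; apply/orP; right; apply/negP => /component_sub /subsetP.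
  by move/(_ s (comp_refl s_addW)); rewrite (negPf s_notinW).
have sJ : joined \subset components e W by apply/subsetP => C /joinedP[].
by rewrite [in RHS](big_setID joined) (setIidPr sJ) /=; lia.
Qed.

Lemma bip_merged_joined C : bipartite e M -> C \in joined -> bipartite e C.
Proof. by move=> bM /joined_sub/bipartiteS; apply. Qed.

(** A bipartite M costs 2, and each component joined to s, being bipartite as well,
    contributes 2. *)
Lemma s_inv_bip_merged : bipartite e M -> (#|joined| <= 1)%N ->
  (s_inv e W <= s_inv e W')%N.
Proof.
move=> bM le1; have := s_inv_add; rewrite bM.
suff -> : (\sum_(C in joined) (1 + bipartite e C) = #|joined| * 2)%N by lia.
rewrite -sum_nat_const; apply: eq_bigr => C CJ.
by rewrite (bip_merged_joined bM CJ).
Qed.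

(** If M is bipartite, the contributions 2 of the joined components add up to at
    most 2. Otherwise contributions 1 or 2 add up to at most 1, which leaves room for
    a single non-bipartite component. *)
Lemma s_inv_not_lt : (s_inv e W <= s_inv e W')%N ->
  (#|joined| <= 1)%N /\ (bipartite e M \/ forall C, C \in joined -> ~~ bipartite e C).
Proof.
move=> le_s; have := s_inv_add.
have [bM|nbM] := boolP (bipartite e M).
  have -> : (\sum_(C in joined) (1 + bipartite e C) = #|joined| * 2)%N.
    rewrite -sum_nat_const; apply: eq_bigr => C CJ.
    by rewrite (bip_merged_joined bM CJ).
  by split; [lia | left].
rewrite big_split sum1_card /= => E; split; first by lia.
right=> C CJ; apply/negP => bC.
have J1 : (1 <= #|joined|)%N by apply/card_gt0P; exists C.
by move: E J1; rewrite (bigD1 C) //= bC; set n := #|_| => E J1; lia.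
Qed.

End AddVertex.

End Components.

(** * Even and odd walks modulo an ideal *)

Section Walks.
Variables (K : fieldType) (V : finType) (e : rel V).
Hypothesis e_sym : ssrbool.symmetric e.
Implicit Types (W S C D : {set V}) (i j k s : V) (Q : set (pring K V)).
Local Notation R := (pring K V).
Local Notation xv := (@xv K V).
Local Notation yv := (@yv K V).

(** With t_i = x_i / y_i, an edge ij says t_i t_j = 1: walks of odd length from i to
    j give t_j = 1 / t_i, those of even length t_j = t_i. *)
Definition even_bin i j : R := xv i * yv j - yv i * xv j.
Definition odd_bin i j : R := xv i * xv j - yv i * yv j.

Definition contains_edges Q W : Prop :=
  forall i j, i \in W -> j \in W -> e i j -> Q (odd_bin i j).

(** The common feature of the ideals J_W, where each variable of W can be cancelled,
    and of the primes that do not contain both variables of a vertex of W, where one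
    of the two can be cancelled. *)
Definition cancels Q W : Prop :=
  forall j f, j \in W -> Q (xv j * f) -> Q (yv j * f) -> Q f.

Lemma even_step Q W i j k : is_ideal Q -> cancels Q W -> j \in W ->
  Q (odd_bin j k) -> Q (even_bin i j) -> Q (odd_bin i k).
Proof.
rewrite /odd_bin /even_bin => QI Qc jW Qjk Qij; apply: (Qc j) => //.
  by apply: (ideal_lin (a := xv i) (b := yv k) QI Qjk Qij); ring.
by apply: (ideal_lin (a := yv i) (b := xv k) QI Qjk Qij); ring.
Qed.

Lemma odd_step Q W i j k : is_ideal Q -> cancels Q W -> j \in W ->
  Q (odd_bin j k) -> Q (odd_bin i j) -> Q (even_bin i k).
Proof.
rewrite /odd_bin /even_bin => QI Qc jW Qjk Qij; apply: (Qc j) => //.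
  by apply: (ideal_lin (a := - yv i) (b := yv k) QI Qjk Qij); ring.
by apply: (ideal_lin (a := - xv i) (b := xv k) QI Qjk Qij); ring.
Qed.

(** The relations t_k = t_i and t_k = 1 / t_i together give t_i^2 = 1. *)
Lemma even_odd_square Q W i k : is_ideal Q -> cancels Q W -> k \in W ->
  Q (even_bin i k) -> Q (odd_bin i k) -> Q (xv i * xv i - yv i * yv i).
Proof.
rewrite /odd_bin /even_bin => QI Qc kW Qe Qo; apply: (Qc k) => //.
  by apply: (ideal_lin (a := yv i) (b := xv i) QI Qe Qo); ring.
by apply: (ideal_lin (a := xv i) (b := yv i) QI Qe Qo); ring.
Qed.

Section Component.
Variables (Q : set R) (W : {set V}) (i : V).
Hypotheses (QI : is_ideal Q) (iW : i \in W).
Hypotheses (Qc : cancels Q (component_at e W i)) (Qe : contains_edges Q (component_at e W i)).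

Lemma even_refl : Q (even_bin i i).
Proof. by rewrite /even_bin mulrC subrr; case: QI. Qed.

Lemma comp_even_or_odd j : j \in component_at e W i -> Q (even_bin i j) \/ Q (odd_bin i j).
Proof.
move: j; apply: comp_ind => // [|j k jC kC ejk [Qij|Qij]]; first by left; exact: even_refl.
  by right; exact: even_step QI Qc jC (Qe jC kC ejk) Qij.
by left; exact: odd_step QI Qc jC (Qe jC kC ejk) Qij.
Qed.

(** Along a path that is properly coloured, the colour records the parity. *)
Lemma comp_colour_bin (side : V -> bool) j :
    (forall k l, k \in component_at e W i -> l \in component_at e W i -> e k l ->
       side k != side l) ->
    j \in component_at e W i ->
  Q (if side i == side j then even_bin i j else odd_bin i j).
Proof.
move=> proper; move: j; apply: comp_ind => // [|j k jC kC ejk].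
  by rewrite eqxx; exact: even_refl.
have := proper j k jC kC ejk; have Qjk := Qe jC kC ejk.
case: (side i) (side j) (side k) => [] [] [] //= _ Qij;
  by [apply: (even_step QI Qc jC Qjk Qij) | apply: (odd_step QI Qc jC Qjk Qij)].
Qed.

Lemma comp_minor (side : V -> bool) j :
    (forall k l, k \in component_at e W i -> l \in component_at e W i -> e k l ->
       side k != side l) ->
    j \in component_at e W i ->
  Q (zv K side i * wv K side j - wv K side i * zv K side j).
Proof.
move=> proper jC; have Qij := comp_colour_bin proper jC.
pose c : R := if side i then 1 else -1.
apply: (ideal_lin (a := c) (b := 0) QI Qij Qij); rewrite /c /zv /wv /even_bin /odd_bin.
by case: (side i) (side j) => [] [] /=; ring.
Qed.

(** If no vertex j has both the even and the odd binomial of i, j in Q, then the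
    vertices with the even one form a colour class of a proper 2-colouring; and a
    vertex with both forces the conclusion by [even_odd_square]. *)
Lemma comp_nonbip_square : ~~ bipartite e (component_at e W i) ->
  Q (xv i * xv i - yv i * yv i).
Proof.
move=> nb; apply: contrapT => nsq.
have not_both j : j \in component_at e W i -> Q (even_bin i j) -> Q (odd_bin i j) -> False.
  by move=> jC Qe' Qo; apply: nsq; exact: even_odd_square QI Qc jC Qe' Qo.
case/negP: nb; apply/bipartiteP; exists [set j | `[< Q (even_bin i j) >]].
move=> j k jC kC ejk; rewrite !inE; have Qjk := Qe jC kC ejk.
have [Qij|Qij] := pselect (Q (even_bin i j)).
  rewrite (asboolT Qij) asboolF // => Qik.
  by apply: (not_both k kC) => //; exact: even_step QI Qc jC Qjk Qij.
rewrite (asboolF Qij) asboolT //.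
case: (comp_even_or_odd jC) => // Qij'.
exact: odd_step QI Qc jC Qjk Qij'.
Qed.

End Component.

(** The sign of the generators of [p_ideal b], as a constant polynomial. *)
Definition eps (b : bool) : R := if b then 1 else -1.

Definition sign_form b i : R := xv i + eps b * yv i.

Lemma eps_sqr b : eps b * eps b = 1.
Proof. by case: b; rewrite /eps; ring. Qed.

Lemma p_genE b i : (if b then xv i + yv i else xv i - yv i) = sign_form b i.
Proof. by case: b; rewrite /sign_form /eps; ring. Qed.

Lemma prime_cancels P W : prime_ideal P ->
    (forall j, j \in W -> ~ (P (xv j) /\ P (yv j))) ->
  cancels P W.
Proof.
move=> /prime_idealP[_ _ PM] nP j f jW /PM[Px|//] /PM[Py|//].
by case: (nP j jW).
Qed.

(** The square x_i^2 - y_i^2 factors, which gives a sign at one vertex i. The sign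
    propagates: x_j = - eps y_j turns an edge binomial into y_j (x_k + eps y_k) up to
    a unit, and y_j in P would entail x_j in P. *)
Lemma prime_signs P W C : prime_ideal P -> cancels P W -> contains_edges P W ->
    C \in components e W -> ~~ bipartite e C ->
  exists b, forall i, i \in C -> P (sign_form b i).
Proof.
move=> Pprime Pc Pe CW nb; have [PI P1 PM] := (prime_idealP P).1 Pprime.
have sCW := subsetP (component_sub CW).
case/componentsP: (CW) => i iW CE.
have {Pe} PeC : contains_edges P C by move=> j k /sCW jW /sCW kW; apply: Pe.
have {Pc} PcC : cancels P C by move=> j f /sCW; apply: Pc.
have /PM sq : P (sign_form true i * sign_form false i).
  have := comp_nonbip_square PI iW; rewrite -CE => /(_ PcC PeC nb) Psq.
  by apply: (ideal_lin (a := 1) (b := 0) PI Psq Psq); rewrite /sign_form /eps; ring.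
have [b Pb] : exists b, P (sign_form b i) by case: sq; [exists true | exists false].
exists b; rewrite CE; apply: comp_ind => // j k; rewrite -CE => jC kC ejk Pj.
have Pjk := PeC j k jC kC ejk.
suff /PM[Py|//] : P (yv j * sign_form b k).
  have Px : P (xv j).
    by apply: (ideal_lin (a := 1) (b := - eps b) PI Pj Py); rewrite /sign_form; ring.
  suff : P 1 by [].
  by apply: (PcC j) => //; rewrite mulr1.
apply: (ideal_lin (a := eps b * xv k) (b := - eps b) PI Pj Pjk).
by have E := eps_sqr b; rewrite /sign_form /odd_bin; ring: E.
Qed.

End Walks.

(** * The candidate primes as kernels *)

Section Candidates.
Variables (K : fieldType) (V : finType) (e : rel V).
Hypothesis e_sym : ssrbool.symmetric e.
Implicit Types (W C D Z : {set V}) (i j k s : V).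
Local Notation R := (pring K V).
Local Notation xv := (@xv K V).
Local Notation yv := (@yv K V).

Section Parametrization.
Variables (S Z : {set V}) (sg : {set V} -> bool) (side : V -> bool).
Hypothesis proper :
  forall i j, bip_vertex e (~: S) i -> j \in ~: S -> e i j -> side i != side j.
Hypothesis ZS : Z \subset S.
Local Notation W := (~: S).
Local Notation rho := (bip_root e W).
Local Notation zv := (zv K side).
Local Notation wv := (wv K side).

Definition sign_at i : R := eps K V (sg (component_at e W i)).

(** The substitutions that are congruences modulo the linear generators of
    m_Z + signed_prime S sg. A set Z inside S is kept as a parameter: Z = S gives the
    prime of I_G, and the empty Z the prime of J_(G_S), in a ring that still contains
    the variables of S. *)
Definition eliminate : R -> R :=
  subst (fun i => if i \in Z then 0 else xv i)
        (fun i => if i \in Z then 0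
                  else if (i \in W) && ~~ bipartite e (component_at e W i)
                       then - sign_at i * xv i else yv i).

HB.instance Definition _ := GRing.RMorphism.on eliminate.

Definition param : R -> R := toric side rho \o eliminate.

HB.instance Definition _ := GRing.RMorphism.on param.

Lemma notinZ i : i \in W -> (i \in Z) = false.
Proof. by rewrite inE; apply: contraNF; exact: (subsetP ZS). Qed.

Lemma param_xZ i : i \in Z -> param (xv i) = 0.
Proof. by move=> iZ; rewrite /param /= /eliminate substx iZ rmorph0. Qed.

Lemma param_yZ i : i \in Z -> param (yv i) = 0.
Proof. by move=> iZ; rewrite /param /= /eliminate substy iZ rmorph0. Qed.

Lemma param_x i : i \notin Z -> param (xv i) = toric side rho (xv i).
Proof. by move=> /negPf iZ; rewrite /param /= /eliminate substx iZ. Qed.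

Lemma param_y i : i \notin Z -> (i \in S) || bip_vertex e W i ->
  param (yv i) = toric side rho (yv i).
Proof.
move=> /negPf iZ; rewrite /bip_vertex inE => bip; rewrite /param /= /eliminate substy iZ inE.
by move: bip; case: (i \in S) => //= ->.
Qed.

Lemma param_y_nonbip i : i \in W -> ~~ bipartite e (component_at e W i) ->
  param (yv i) = - sign_at i * toric side rho (xv i).
Proof.
move=> iW nb; rewrite /param /= /eliminate substy notinZ // iW nb rmorphM rmorphN /=.
by rewrite /sign_at /eps; case: (sg _); rewrite ?rmorphN rmorph1.
Qed.

Lemma param_zw i : bip_vertex e W i -> param (zv i) = zv (rho i) * wv i /\ param (wv i) = wv i.
Proof.
move=> bip; have iW : i \in W by case/andP: bip.
have iZ : i \notin Z by rewrite notinZ.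
suff [-> ->] : param (zv i) = toric side rho (zv i) /\ param (wv i) = toric side rho (wv i).
  by rewrite toric_z toric_w.
by rewrite /zv /wv; case: (side i); rewrite param_x // param_y ?bip ?orbT.
Qed.

Lemma toric_X_neq0 (k : 'I_(#|V| + #|V|)) : toric side rho ('X_k : R) != 0.
Proof. by rewrite toric_X mpolyX_neq0. Qed.

Lemma sign_at_neq0 i : sign_at i != 0.
Proof. by rewrite /sign_at /eps; case: (sg _); rewrite ?oppr_eq0 oner_eq0. Qed.

Lemma param_x_neq0 i : i \notin Z -> param (xv i) != 0.
Proof. by move=> iZ; rewrite param_x // toric_X_neq0. Qed.

Lemma param_y_neq0 i : i \notin Z -> param (yv i) != 0.
Proof.
move=> iZ; have [iS|iW] := boolP (i \in S); first by rewrite param_y ?iS // toric_X_neq0.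
have {}iW : i \in W by rewrite inE.
have [bip|nb] := boolP (bipartite e (component_at e W i)).
  by rewrite param_y ?toric_X_neq0 // /bip_vertex iW bip orbT.
by rewrite param_y_nonbip // mulf_neq0 ?toric_X_neq0 // oppr_eq0 sign_at_neq0.
Qed.

Lemma param_edges : contains_edges e [set f | param f = 0]%classic W.
Proof.
move=> i j iW jW eij /=; have jC : j \in component_at e W i.
  exact: component_edge (comp_components e iW) (comp_refl e iW) jW eij.
have [bip|nb] := boolP (bipartite e (component_at e W i)).
  have bi : bip_vertex e W i by rewrite /bip_vertex iW.
  have bj := bip_vertex_comp e_sym jC bi.
  have [zi wi] := param_zw bi; have [zj wj] := param_zw bj.
  have zw0 : param (zv i * wv j - wv i * zv j) = 0.
    by rewrite rmorphB !rmorphM /= zi wi zj wj (bip_root_comp e_sym bi jC); ring.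
  move: (proper bi jW eij) zw0; rewrite /zv /wv /odd_bin.
  case: (side i) (side j) => [] [] //= _ zw0.
  by rewrite -opprB rmorphN /= zw0 oppr0.
have nbj : ~~ bipartite e (component_at e W j) by rewrite (comp_eq e_sym jC).
rewrite /odd_bin rmorphB !rmorphM /= !param_x ?notinZ // !param_y_nonbip //.
rewrite /sign_at (comp_eq e_sym jC).
have E := eps_sqr K V (sg (component_at e W i)); ring: E.
Qed.

(** On a bipartite component the image of x_i + eps y_i is, up to a unit, the product
    of w_i and z_r + eps; on a non-bipartite one it is a multiple of
    1 - eps (sign_at i). *)
Lemma param_sign_form i b : i \in W -> param (sign_form K b i) = 0 <->
  ~~ bip_vertex e W i /\ eps K V b = sign_at i.
Proof.
move=> iW; rewrite /sign_form rmorphD rmorphM /=.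
have -> : param (eps K V b) = eps K V b.
  by rewrite /eps; case: b; rewrite ?rmorphN rmorph1.
have [bi|] := boolP (bip_vertex e W i).
  split=> [|[]//] phi0; exfalso; have [zi wi] := param_zw bi.
  have zb : zv (rho i) + eps K V b != 0.
    apply/eqP => /(congr1 (meval (fun=> 0 : K))); rewrite zvE mevalD mevalXU add0r meval0.
    by rewrite /eps; case: b {phi0}; rewrite ?mevalN meval1; apply/eqP; rewrite ?oppr_eq0 oner_eq0.
  have : wv i * (zv (rho i) + eps K V b) = 0.
    move: zi wi phi0; rewrite /zv /wv; case: (side i) => -> -> E.
      by rewrite -E; ring.
    have E2 := eps_sqr K V b; rewrite -[LHS]mul1r -E2.
    by rewrite -[RHS](mulr0 (eps K V b)) -E; ring: E2.
  by apply/eqP; rewrite mulf_neq0 // wvE mpolyX_neq0.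
rewrite /bip_vertex iW /= => nb; rewrite param_x ?notinZ // param_y_nonbip //.
split=> [E|[_ ->]]; last first.
  by have E2 := eps_sqr K V (sg (component_at e W i)); rewrite /sign_at; ring: E2.
split=> //; have E2 := eps_sqr K V (sg (component_at e W i)).
have : toric side rho (xv i) * (1 - eps K V b * sign_at i) = 0 by rewrite -E; ring.
move/eqP; rewrite mulf_eq0 (negPf (toric_X_neq0 _)) /= subr_eq0 => /eqP E3.
by rewrite -[LHS]mulr1 -E2 mulrA -E3 mul1r.
Qed.

Lemma zv_inj i j : zv i - zv j = 0 -> i = j.
Proof.
move=> /(congr1 (meval (fun k : 'I_(#|V| + #|V|) => (k == z_index side i)%:R : K))).
rewrite !zvE mevalB !mevalXU meval0 eqxx z_index_eq.
by case: eqP => // _ /eqP; rewrite subr0 oner_eq0.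
Qed.

Lemma zvM_neq1 i j : zv i * zv j - 1 != 0.
Proof.
apply/eqP => /(congr1 (meval (fun=> 0 : K))).
rewrite !zvE mevalB mevalM !mevalXU meval0 meval1 mul0r sub0r.
by apply/eqP; rewrite oppr_eq0 oner_eq0.
Qed.

(** Up to sign the images are w_i w_j (z_r - z_r') or w_i w_j (z_r z_r' - 1), for the
    roots r, r' of i and j. Only the first one can vanish, and only if r = r'. *)
Lemma param_walk i j : bip_vertex e W i -> bip_vertex e W j ->
  param (even_bin K i j) = 0 \/ param (odd_bin K i j) = 0 -> j \in component_at e W i.
Proof.
move=> bi bj walk; have iW : i \in W by case/andP: bi.
suff /(bip_rootP e_sym)[<-|[]//] : rho i = rho j by exact: comp_refl.
have w0 k : wv k != 0 by rewrite wvE mpolyX_neq0.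
have [zi wi] := param_zw bi; have [zj wj] := param_zw bj.
have cancelw f : wv i * wv j * f = 0 -> f = 0.
  by move/eqP; rewrite mulf_eq0 (negPf (mulf_neq0 (w0 i) (w0 j))) => /eqP.
suff : zv (rho i) - zv (rho j) = 0 \/ zv (rho i) * zv (rho j) - 1 = 0.
  by case=> [/zv_inj // | /eqP]; rewrite (negPf (zvM_neq1 _ _)).
have zw f : param f = 0 -> f = zv i * wv j - wv i * zv j \/ f = wv i * zv j - zv i * wv j ->
    zv (rho i) - zv (rho j) = 0.
  move=> f0 fE; apply: cancelw; case: fE => E; [rewrite -f0 E | rewrite -[RHS]oppr0 -f0 E];
    by rewrite rmorphB !rmorphM /= zi wi zj wj; ring.
have zz f : param f = 0 -> f = zv i * zv j - wv i * wv j \/ f = wv i * wv j - zv i * zv j ->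
    zv (rho i) * zv (rho j) - 1 = 0.
  move=> f0 fE; apply: cancelw; case: fE => E; [rewrite -f0 E | rewrite -[RHS]oppr0 -f0 E];
    by rewrite rmorphB !rmorphM /= zi wi zj wj; ring.
case: walk => f0; [have := zw _ f0 | have := zw _ f0]; have := zz _ f0;
  rewrite /even_bin /odd_bin /zv /wv; case: (side i) (side j) => [] [] zz' zw'; try tauto.
Qed.

(** Modulo Q a polynomial may be replaced by its image under [eliminate], and then the
    kernel of the toric map is reached by the minors. *)
Lemma param_kernel (Q : set R) : is_ideal Q ->
    (forall i, i \in Z -> Q (xv i) /\ Q (yv i)) ->
    (forall i, i \in W -> ~~ bipartite e (component_at e W i) ->
       Q (sign_form K (sg (component_at e W i)) i)) ->
    (forall i j, bip_vertex e W i -> j \in component_at e W i ->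
       Q (zv i * wv j - wv i * zv j)) ->
  forall f, param f = 0 -> Q f.
Proof.
move=> QI QZ Qsign Qminor f f0; have [Q0 _] := QI.
have Qf : Q (f - eliminate f).
  apply: subst_congr => // i; first by case: ifP => [/QZ[Qx _]|_]; rewrite ?subr0 ?subrr.
  case: ifP => [/QZ[_ Qy]|_]; first by rewrite subr0.
  case: ifP => [/andP[iW nb]|_]; last by rewrite subrr.
  have Qi := Qsign i iW nb; have E := eps_sqr K V (sg (component_at e W i)).
  apply: (ideal_lin (a := sign_at i) (b := 0) QI Qi Qi).
  by rewrite /sign_at /sign_form; ring: E.
rewrite -[f](subrK (eliminate f)); apply: idealD => //.
apply: (@toric_kernel _ _ side rho) => // i j /(bip_rootP e_sym)[<-|[]]; last exact: Qminor.
by rewrite mulrC subrr.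
Qed.

End Parametrization.
End Candidates.

Section CandidateIdeals.
Variables (K : fieldType) (V : finType) (e : rel V).
Hypothesis e_sym : ssrbool.symmetric e.
Implicit Types (S W C D Z : {set V}) (i j k s : V).
Local Notation R := (pring K V).
Local Notation xv := (@xv K V).
Local Notation yv := (@yv K V).

Lemma parity_ideal_ideal W : is_ideal (parity_ideal K e W).
Proof. exact: ideal_gen_ideal. Qed.

Lemma J_ideal_ideal W : is_ideal (J_ideal (K := K) e W).
Proof. exact/ideal_sat_ideal/parity_ideal_ideal. Qed.

Lemma parity_edges W : contains_edges e (parity_ideal K e W) W.
Proof. by move=> i j iW jW eij; apply: mem_ideal_gen; exists i, j. Qed.

Lemma contains_edgesP W (Q : set R) : is_ideal Q ->
  contains_edges e Q W <-> (parity_ideal K e W `<=` Q)%classic.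
Proof.
move=> QI; split=> [Qe|sub i j iW jW eij]; last exact/sub/parity_edges.
by apply: ideal_gen_sub => // f [i [j [iW jW eij ->]]]; apply: Qe.
Qed.

Lemma J_edges W : contains_edges e (J_ideal (K := K) e W) W.
Proof. by move=> i j iW jW eij; apply: sub_ideal_sat; apply: parity_edges. Qed.

(** J_W is saturated at the product of all variables of W. *)
Lemma J_cancels W : cancels (J_ideal (K := K) e W) W.
Proof.
move=> j f jW Jxf _.
apply: (ideal_sat_cancel (c := xv j)
  (d := yv j * \prod_(i in W | i != j) (xv i * yv i)) _ _ Jxf).
  exact: parity_ideal_ideal.
by rewrite (bigD1 j) //= mulrA.
Qed.

Lemma m_ideal_ideal Z : is_ideal (m_ideal K Z).
Proof. exact: ideal_gen_ideal. Qed.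

Lemma sign_form_p_ideal b C i : i \in C -> p_ideal (K := K) b C (sign_form K b i).
Proof. by move=> iC; apply: mem_ideal_gen; exists i; rewrite ?p_genE. Qed.

Lemma summand_ideal (sg : {set V} -> bool) C :
  is_ideal (if bipartite e C then J_ideal (K := K) e C else p_ideal (sg C) C).
Proof. by case: ifP => _; [exact: J_ideal_ideal | exact: ideal_gen_ideal]. Qed.

Lemma signed_prime_ideal S sg : is_ideal (signed_prime (K := K) e S sg).
Proof. by apply: big_ideal_add_ideal => C; exact: summand_ideal. Qed.

Lemma sub_signed_prime S sg C f : C \in components e (~: S) ->
    (if bipartite e C then J_ideal (K := K) e C else p_ideal (sg C) C) f ->
  signed_prime e S sg f.
Proof.
move=> CW Cf; apply: sub_big_ideal_add Cf => // D; exact: summand_ideal.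
Qed.

Definition candidate S Z sg : set R := ideal_add (m_ideal K Z) (signed_prime e S sg).

Lemma candidate_set0 S sg : candidate S set0 sg = signed_prime e S sg.
Proof.
apply/seteqP; split=> f /=; last exact/sub_ideal_addr/m_ideal_ideal.
case=> g mg [h ph ->]; suff -> : g = 0 by rewrite add0r.
move: g mg; apply: (@ideal_gen_sub _ _ [set 0]%classic) => [|g [s]]; last by rewrite inE.
by split=> // a u v /= -> ->; rewrite mulr0 addr0.
Qed.

Section Kernel.
Variables (S Z : {set V}) (sg : {set V} -> bool) (side : V -> bool).
Hypothesis proper :
  forall i j, bip_vertex e (~: S) i -> j \in ~: S -> e i j -> side i != side j.
Hypothesis ZS : Z \subset S.
Local Notation W := (~: S).
Local Notation param := (param (K := K) e S Z sg side).

Lemma param_prime : prime_ideal [set f | param f = 0]%classic.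
Proof. exact: kernel_prime. Qed.

Lemma param_prod_neq0 C : C \subset W -> param (\prod_(i in C) (xv i * yv i)) != 0.
Proof.
move=> /subsetP sCW; rewrite rmorph_prod; apply/prodf_neq0 => i /sCW iW.
have iZ : i \notin Z by rewrite (notinZ ZS iW).
rewrite rmorphM mulf_eq0 negb_or; apply/andP; split; first exact: param_x_neq0.
exact: param_y_neq0.
Qed.

(** The map kills I_C but no variable of C, so its kernel is saturated at these
    variables. *)
Lemma param_J C : C \in components e W -> (J_ideal (K := K) e C `<=` [set f | param f = 0])%classic.
Proof.
move=> CW f [k]; have [kerI _ _] := (prime_idealP _).1 param_prime.
have sCW := subsetP (component_sub CW).
have kerC : contains_edges e [set f | param f = 0]%classic C.
  by move=> i j /sCW iW /sCW jW; apply: param_edges.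
move/((contains_edgesP C kerI).1 kerC) => /=; rewrite rmorphM rmorphXn /= => /eqP.
rewrite mulf_eq0 => /orP[/eqP //|]; rewrite expf_eq0 => /andP[_].
by rewrite (negPf (param_prod_neq0 (component_sub CW))).
Qed.

Lemma component_minor (Q : set R) i j : is_ideal Q ->
    cancels Q (component_at e W i) -> contains_edges e Q (component_at e W i) ->
    bip_vertex e W i -> j \in component_at e W i ->
  Q (zv K side i * wv K side j - wv K side i * zv K side j).
Proof.
move=> QI Qc Qe bi; have iW : i \in W by case/andP: bi.
apply: comp_minor => // k l kC lC; apply: proper; first exact: bip_vertex_comp bi.
exact: (subsetP (comp_sub e W i)).
Qed.

(** The generators of the candidate are killed, and conversely the ideals J_B contain
    all minors that [param_kernel] asks for, as they allow cancellation along paths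
    ([comp_minor]). *)
Lemma candidate_kernel : candidate S Z sg = [set f | param f = 0]%classic.
Proof.
have [kerI _ _] := (prime_idealP _).1 param_prime.
have sgI := signed_prime_ideal S sg; have mI := m_ideal_ideal Z.
have cI : is_ideal (candidate S Z sg) by exact: ideal_add_ideal.
apply/seteqP; split=> f; last first.
  apply: param_kernel => // [i iZ|i iW nb|i j bi jC].
  - by split; apply: sub_ideal_addl => //; apply: mem_ideal_gen; exists i; auto.
  - apply: sub_ideal_addr => //; apply: (sub_signed_prime (comp_components e iW)).
    by rewrite (negPf nb); exact/sign_form_p_ideal/comp_refl.
  - have iW : i \in W by case/andP: bi.
    apply: sub_ideal_addr => //; apply: (sub_signed_prime (comp_components e iW)).
    have /andP[_ ->] := bi; apply: component_minor => //; first exact: J_ideal_ideal.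
      exact: J_cancels.
    exact: J_edges.
case=> g mg [h ph ->]; apply: idealD => //; move: g mg h ph.
  move=> g mg _ _; move: g mg; apply: ideal_gen_sub => // g [s sZ [] ->] /=.
    exact: param_xZ.
  exact: param_yZ.
move=> _ _; apply: big_ideal_add_sub => // C _ CW; case: ifPn => [_|nb].
  exact: param_J.
apply: ideal_gen_sub => // g [i iC ->]; have iW := subsetP (component_sub CW) _ iC.
rewrite p_genE /=; apply/param_sign_form => //.
by rewrite (bip_vertex_component e_sym CW iC) nb /sign_at -(component_eq e_sym CW iC).
Qed.

End Kernel.

(** The colouring that enters the parametrization is an artefact; the properties
    needed later are stated without it. *)

Section Facts.
Variables (S Z : {set V}) (sg : {set V} -> bool).
Hypothesis ZS : Z \subset S.
Local Notation W := (~: S).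
Local Notation Q := (candidate S Z sg).

Lemma candidate_prime : prime_ideal Q.
Proof.
have [side proper] := exists_colouring e_sym W.
by rewrite (candidate_kernel sg proper ZS); exact: param_prime.
Qed.

Lemma candidate_vars i : i \in Z -> Q (xv i) /\ Q (yv i).
Proof.
move=> iZ; have sI := signed_prime_ideal S sg.
by split; apply: sub_ideal_addl => //; apply: mem_ideal_gen; exists i; auto.
Qed.

Lemma candidate_nvars i : i \notin Z -> ~ Q (xv i) /\ ~ Q (yv i).
Proof.
move=> iZ; have [side proper] := exists_colouring e_sym W.
rewrite (candidate_kernel sg proper ZS) /=.
by split; apply/eqP; [exact: param_x_neq0 | exact: param_y_neq0].
Qed.

Lemma candidate_cancels : cancels Q (~: Z).
Proof.
apply: prime_cancels candidate_prime _ => j; rewrite inE => jZ [Qx _].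
by case: (candidate_nvars jZ).
Qed.

Lemma candidate_edges : contains_edges e Q W.
Proof.
have [side proper] := exists_colouring e_sym W.
by rewrite (candidate_kernel sg proper ZS); exact: param_edges.
Qed.

Lemma candidate_J : (J_ideal e W `<=` Q)%classic.
Proof.
have [QI _ QM] := (prime_idealP _).1 candidate_prime.
move=> f [k]; move/((contains_edgesP W QI).1 candidate_edges)/QM => [//|Qm]; exfalso.
have /(_ Qm) [] : ~ Q ((\prod_(i in W) (xv i * yv i)) ^+ k).
have [side proper] := exists_colouring e_sym W.
rewrite (candidate_kernel sg proper ZS) /=; apply/eqP; rewrite rmorphXn /=.
by apply: expf_neq0; apply: param_prod_neq0.
Qed.

Lemma candidate_sign b C i : C \in components e W -> i \in C ->
  Q (sign_form K b i) <-> ~~ bipartite e C /\ eps K V b = eps K V (sg C).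
Proof.
move=> CW iC; have iW := subsetP (component_sub CW) _ iC.
have [side proper] := exists_colouring e_sym W.
rewrite (candidate_kernel sg proper ZS) /= -(bip_vertex_component e_sym CW iC).
by rewrite (component_eq e_sym CW iC); exact: param_sign_form.
Qed.

Lemma candidate_walk i j : bip_vertex e W i -> bip_vertex e W j ->
  Q (even_bin K i j) \/ Q (odd_bin K i j) -> j \in component_at e W i.
Proof.
have [side proper] := exists_colouring e_sym W.
by rewrite (candidate_kernel sg proper ZS); exact: param_walk.
Qed.

(** The minors stand for the ideals J_B. They are simpler to test for membership than
    J_B itself: J_B is a saturation, and P may contain variables of B. *)
Lemma candidate_sub (P : set R) : is_ideal P ->
    (forall i, i \in Z -> P (xv i) /\ P (yv i)) ->
    (forall C i, C \in components e W -> ~~ bipartite e C -> i \in C ->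
       P (sign_form K (sg C) i)) ->
    (forall (side : V -> bool) i j, bip_vertex e W i -> j \in component_at e W i ->
       (forall k l, k \in component_at e W i -> l \in component_at e W i -> e k l ->
          side k != side l) ->
       P (zv K side i * wv K side j - wv K side i * zv K side j)) ->
  (Q `<=` P)%classic.
Proof.
move=> PI PZ Psign Pminor; have [side proper] := exists_colouring e_sym W.
rewrite (candidate_kernel sg proper ZS) => f; apply: param_kernel => // [i iW nb|i j bi jC].
  by apply: Psign nb _; [exact: comp_components | exact: comp_refl].
apply: Pminor => // k l kC lC; apply: proper; first exact: bip_vertex_comp bi.
exact: (subsetP (comp_sub e W i)).
Qed.

End Facts.

End CandidateIdeals.

(** * Inclusions between candidates *)

Section Inclusions.
Variables (K : fieldType) (V : finType) (e : rel V).
Hypothesis e_sym : ssrbool.symmetric e.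
Implicit Types (S T W C D Z : {set V}) (i j k s : V) (sg : {set V} -> bool).
Implicit Types (P : set (pring K V)).
Local Notation R := (pring K V).
Local Notation xv := (@xv K V).
Local Notation yv := (@yv K V).
Local Notation eps := (eps K V).

Lemma eps_pchar2 b c : 2%N \in [pchar K] -> eps b = eps c.
Proof.
move=> ch2; have E : (-1 : R) = 1 by rewrite -mpolyC1 -mpolyCN oppr_pchar2.
by rewrite /eps; case: b; case: c; rewrite ?E.
Qed.

Lemma eps_inj b c : eps b = eps c -> b = c \/ 2%N \in [pchar K].
Proof.
have H : (1 : R) = -1 -> 2%N \in [pchar K].
  move=> /(congr1 (mcoeff 0%MM)); rewrite mcoeffN mcoeff1 eqxx => /= E.
  by rewrite inE /= mulr2n [X in X + _]E addNr.
rewrite /eps; case: b; case: c => E; auto.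
Qed.

Lemma sign_form_eps b c i : eps b = eps c -> sign_form K b i = sign_form K c i.
Proof. by rewrite /sign_form => ->. Qed.

(** Since P lies inside the candidate, it contains no further variables, so it allows
    cancellation outside S. This yields the minors, and also signs on the
    non-bipartite components; the signs coincide with those of the candidate up to
    the ambiguity in characteristic 2, which is invisible in the linear forms. *)
Lemma eq_candidate S Z sg P : Z \subset S -> prime_ideal P ->
    (forall i, i \in Z -> P (xv i) /\ P (yv i)) -> contains_edges e P (~: S) ->
    (P `<=` candidate e S Z sg)%classic ->
  P = candidate e S Z sg.
Proof.
move=> ZS Pprime PZ Pe Psub; have [PI _ _] := (prime_idealP P).1 Pprime.
have Pc : cancels P (~: S).
  apply: prime_cancels => // j; rewrite inE => jS [/Psub Qx _].
  have jZ : j \notin Z by apply: contra jS; exact: (subsetP ZS).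
  by case: (candidate_nvars K e_sym sg ZS jZ).
apply/seteqP; split=> //; apply: candidate_sub => // [C i CW nb iC|side i j bi jC proper].
  have [b Pb] := prime_signs e_sym Pprime Pc Pe CW nb.
  have [_ eb] := (candidate_sign K e_sym sg ZS b CW iC).1 (Psub _ (Pb i iC)).
  by rewrite -(sign_form_eps i eb); apply: Pb.
have iW : i \in ~: S by case/andP: bi.
have sub := subsetP (comp_sub e (~: S) i).
apply: (comp_minor e_sym PI iW) => // [k f /sub|k l /sub kW /sub lW]; first exact: Pc.
exact: Pe.
Qed.

Lemma signed_prime_minimal S sg :
  minimal_prime (J_ideal e (~: S)) (signed_prime (K := K) e S sg).
Proof.
rewrite -candidate_set0; have Z0 := sub0set S; split=> [||P Pprime JP Psub].
- exact: candidate_prime.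
- exact: candidate_J.
- apply: eq_candidate => // [i|i j iW jW eij]; first by rewrite inE.
  by apply: JP; apply: J_edges.
Qed.

Lemma candidate_parity_ideal S sg :
  (parity_ideal K e [set: V] `<=` candidate e S S sg)%classic.
Proof.
have SS := subxx S; have [QI _ _] := (prime_idealP _).1 (candidate_prime K e_sym sg SS).
apply/contains_edgesP => // i j _ _ eij.
have Sbin k l : k \in S \/ l \in S -> candidate e S S sg (odd_bin K k l).
  case=> /(candidate_vars K e S sg) [Qx Qy].
    by apply: (ideal_lin (a := xv l) (b := - yv l) QI Qx Qy); rewrite /odd_bin; ring.
  by apply: (ideal_lin (a := xv k) (b := - yv k) QI Qx Qy); rewrite /odd_bin; ring.
have [iS|iW] := boolP (i \in S); first by apply: Sbin; left.
have [jS|jW] := boolP (j \in S); first by apply: Sbin; right.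
by apply: candidate_edges => //; rewrite inE.
Qed.

(** The sign + is preferred whenever it is possible, which makes the sign vector
    admissible: in characteristic 2 it is always possible. *)
Lemma prime_admissible_signs P S : prime_ideal P -> cancels P (~: S) ->
    contains_edges e P (~: S) ->
  exists sg, admissible_signs K e S sg /\
    forall C i, C \in components e (~: S) -> ~~ bipartite e C -> i \in C ->
      P (sign_form K (sg C) i).
Proof.
move=> Pprime Pc Pe.
exists (fun C => `[< forall i, i \in C -> P (sign_form K true i) >]); split.
  move=> ch2 C CW nb; have [b Pb] := prime_signs e_sym Pprime Pc Pe CW nb.
  by apply/asboolP => i iC; rewrite (sign_form_eps i (eps_pchar2 true b ch2)); apply: Pb.
move=> C i CW nb iC; case: asboolP => [all_true|no]; first exact: all_true.
have [[|] Pb] := prime_signs e_sym Pprime Pc Pe CW nb; last exact: Pb.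
by case: no.
Qed.

(** Only the component M of s differs from a component of G_S. If M is not bipartite,
    give it the common sign of the components joined to s. If it is bipartite, its
    vertices other than s lie in a single component of G_S, so the minors of J_M that
    do not involve the variables of s are minors of that component. *)
Lemma candidate_add_vertex S sg s : s \in S ->
    (bipartite e (component_at e (~: (S :\ s)) s) /\
       (#|joined_components e S s| <= 1)%N) \/
    (~~ bipartite e (component_at e (~: (S :\ s)) s) /\
       exists b, forall C, C \in joined_components e S s ->
         ~~ bipartite e C /\ sg C = b) ->
  exists sg', (candidate e (S :\ s) (S :\ s) sg' `<=` candidate (K := K) e S S sg)%classic.
Proof.
move=> sS H; have SS := subxx S.
have [QI _ _] := (prime_idealP _).1 (candidate_prime K e_sym sg SS).
have [b Hb] : exists b, ~~ bipartite e (component_at e (~: (S :\ s)) s) ->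
    forall C, C \in joined_components e S s -> ~~ bipartite e C /\ sg C = b.
  by case: H => [[-> _]|[_ [b Hb]]]; [exists true | exists b].
have le1 : bipartite e (component_at e (~: (S :\ s)) s) -> (#|joined_components e S s| <= 1)%N.
  by case: H => [[_ ?] //|[/negPf -> _]].
have sW' : s \in ~: (S :\ s) := s_addW S s.
have far C : C \in components e (~: (S :\ s)) -> s \notin C -> C \in components e (~: S).
  move=> CW' sC; move: CW'; rewrite (components_addE e_sym S s) in_setU1 in_setD.
  case/predU1P => [E|/andP[]//]; by rewrite E comp_refl in sC.
exists (fun C => if s \in C then b else sg C).
apply: candidate_sub => // [i|C i CW' nb iC|side i j bi jC proper].
- by rewrite in_setD1 => /andP[_]; exact: candidate_vars.
- have [iS|iW] := boolP (i \in S).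
    have [Qx Qy] := candidate_vars K e S sg iS.
    by rewrite /sign_form; apply: idealD => //; apply: idealM.
  have {}iW : i \in ~: S by rewrite inE.
  have [sC|sC] := boolP (s \in C); last first.
    exact: (candidate_sign K e_sym sg SS (sg C) (far C CW' sC) iC).2 (conj nb erefl).
  have CM := component_eq e_sym CW' sC.
  have iJ : component_at e (~: S) i \in joined_components e S s.
    by apply: mem_merged => //; rewrite /merged_component -CM.
  rewrite CM in nb; have [nbi sgi] := Hb nb _ iJ.
  apply/(candidate_sign K e_sym sg SS b (comp_components e iW) (comp_refl e iW)).
  by rewrite sgi.
- have iW' : i \in ~: (S :\ s) by case/andP: bi.
  have jW' := subsetP (comp_sub e _ i) _ jC.
  have Qzw k : k \in S -> candidate e S S sg (zv K side k) /\ candidate e S S sg (wv K side k).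
    by move=> /(candidate_vars K e S sg) [Qx Qy]; rewrite /zv /wv; case: (side k).
  have [iS|iW] := boolP (i \in S).
    have [Qz Qw] := Qzw i iS.
    by apply: (ideal_lin (a := wv K side j) (b := - zv K side j) QI Qz Qw); ring.
  have [jS|jW] := boolP (j \in S).
    have [Qz Qw] := Qzw j jS.
    by apply: (ideal_lin (a := - wv K side i) (b := zv K side i) QI Qz Qw); ring.
  have {}iW : i \in ~: S by rewrite inE.
  have {}jW : j \in ~: S by rewrite inE.
  have jCi : j \in component_at e (~: S) i.
    have [sC|sC] := boolP (s \in component_at e (~: (S :\ s)) i); last first.
      rewrite -(component_eq e_sym (far _ (comp_components e iW') sC)) //.
      exact: comp_refl.
    have E := comp_eq e_sym sC; have /andP[_] := bi; rewrite -E => /le1 le1J.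
    have iJ : component_at e (~: S) i \in joined_components e S s.
      by apply: mem_merged => //; rewrite /merged_component E comp_refl.
    have jJ : component_at e (~: S) j \in joined_components e S s.
      by apply: mem_merged => //; rewrite /merged_component E.
    by rewrite -(card_le1_eqP le1J _ _ iJ jJ) comp_refl.
  have sub := subsetP (comp_sub e (~: S) i).
  have subC := subsetP (comp_mono e_sym iW (subW S s)).
  apply: (comp_minor e_sym QI iW) => // [k f /sub|k l /sub kW /sub lW|k l /subC kC /subC lC].
  + exact: candidate_cancels.
  + exact: candidate_edges.
  + exact: proper.
Qed.

Definition zero_set P : {set V} := [set i | `[< P (xv i) /\ P (yv i) >]].

Lemma zero_setP P i : reflect (P (xv i) /\ P (yv i)) (i \in zero_set P).
Proof. by rewrite inE; exact: asboolP. Qed.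

Lemma zero_set_cancels P : prime_ideal P -> cancels P (~: zero_set P).
Proof. by move=> Pprime; apply: prime_cancels => // j; rewrite inE => /zero_setP. Qed.

(** Suppose that s is missing in the zero set T of P, and let D be the component of s
    in G_T; it contains all components C of G_S that are joined to s. If D is
    bipartite, the binomials of walks between two such C lie in P, hence in the
    candidate, which is impossible for distinct components: so there is at most one
    C, and S is no disconnector at s. Otherwise the linear forms of P on D
    force every C to be non-bipartite with the sign of D, against sign-splitness; in
    characteristic 2 they only force C to be non-bipartite, and admissibility
    provides the common sign. *)
Lemma sign_split_zero_set S sg P : disconnector e S -> admissible_signs K e S sg ->
    sign_split_signs e S sg -> prime_ideal P ->
    (parity_ideal K e [set: V] `<=` P)%classic ->
    (P `<=` candidate e S S sg)%classic ->
  forall s, s \in S -> P (xv s) /\ P (yv s).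
Proof.
move=> Sdis sg_adm sg_split Pprime IP Psub s sS; have SS := subxx S.
have [PI _ _] := (prime_idealP P).1 Pprime.
set T := zero_set P; apply/zero_setP; apply: contraT => sT.
have Pe W : contains_edges e P W.
  by move=> i j iW jW eij; apply: IP; apply: parity_edges => //; rewrite inE.
have TS : T \subset S :\ s.
  apply/subsetP => i iT; rewrite in_setD1; apply/andP; split.
    by apply: contraNneq sT => <-.
  apply: contraT => iS; have [/Psub Qx _] := zero_setP P i iT.
  by case: (candidate_nvars K e_sym sg SS iS).
have Pc := zero_set_cancels Pprime; rewrite -/T in Pc.
have sWT : s \in ~: T by rewrite inE.
have sub' : ~: (S :\ s) \subset ~: T by rewrite setCS.
set D := component_at e (~: T) s.
have DT : D \in components e (~: T) by exact: comp_components.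
have MD : component_at e (~: (S :\ s)) s \subset D by apply: comp_mono sub' => //; exact: s_addW.
have JD C : C \in joined_components e S s -> C \subset D.
  by move=> CJ; apply: subset_trans MD; exact: joined_sub.
have JW C : C \in joined_components e S s -> C \in components e (~: S).
  by case/joinedP.
have J0 C : C \in joined_components e S s -> exists i, i \in C.
  by case/joinedP => _ [v]; exists v.
have [bD|nbD] := boolP (bipartite e D).
  suff : (#|joined_components e S s| <= 1)%N.
    by move/(s_inv_bip_merged e_sym sS (bipartiteS MD bD)); rewrite leqNgt Sdis.
  apply/card_le1_eqP => C C' CJ C'J; have [i iC] := J0 _ CJ; have [j jC'] := J0 _ C'J.
  have iD := subsetP (JD _ CJ) _ iC; have jD := subsetP (JD _ C'J) _ jC'.
  have iT := subsetP (component_sub DT) _ iD.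
  have bip k B : B \in joined_components e S s -> k \in B -> bip_vertex e (~: S) k.
    move=> BJ kB; rewrite (bip_vertex_component e_sym (JW _ BJ) kB).
    exact: bipartiteS (JD _ BJ) bD.
  have walk : P (even_bin K i j) \/ P (odd_bin K i j).
    have Di : D = component_at e (~: T) i by exact: component_eq.
    apply: (comp_even_or_odd e_sym PI iT) => [k f kC||]; rewrite -?Di //.
    by apply: Pc; rewrite -Di in kC; exact: (subsetP (component_sub DT)).
  have /(candidate_walk e_sym SS (bip i C CJ iC) (bip j C' C'J jC')) :
      candidate e S S sg (even_bin K i j) \/ candidate e S S sg (odd_bin K i j).
    by case: walk => /Psub; [left | right].
  rewrite -(component_eq e_sym (JW _ CJ) iC) => jC.
  by rewrite (component_eq e_sym (JW _ CJ) jC) (component_eq e_sym (JW _ C'J) jC').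
have [b Pb] := prime_signs e_sym Pprime Pc (Pe _) DT nbD.
have Jsign C : C \in joined_components e S s -> ~~ bipartite e C /\ eps b = eps (sg C).
  move=> CJ; have [i iC] := J0 _ CJ.
  apply/(candidate_sign K e_sym sg SS b (JW _ CJ) iC)/Psub/Pb.
  exact: (subsetP (JD _ CJ)).
have [ntrue nfalse] := sg_split s sS (fun C CJ => (Jsign C CJ).1).
have [ch2|nch2] := boolP (2%N \in [pchar K]).
  by case: ntrue => C CJ; apply: sg_adm => //; [exact: JW | exact: (Jsign C CJ).1].
have sgb C : C \in joined_components e S s -> sg C = b.
  by move=> CJ; case: (eps_inj (Jsign C CJ).2) => [-> //|]; rewrite (negPf nch2).
by case: b sgb {Pb Jsign} => sgb; [case: ntrue | case: nfalse].
Qed.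

End Inclusions.

Theorem theorem4p15 (K : fieldType) (V : finType) (e : rel V)
    (e_sym : ssrbool.symmetric e) (e_irr : irreflexive e)
    (G_conn : connected_graph e) (P : set (pring K V)) :
  minimal_prime (parity_ideal K e [set: V]%SET) P <->
  exists (S : {set V}) (p : set (pring K V)),
    [/\ disconnector e S,
        sign_split_minimal_prime e S p
      & P = ideal_add (m_ideal K S) p].
Proof.
split=> [[Pprime IP Pmin] | [S [p [Sdis [_ [sg [sg_adm -> sg_split]]] ->]]]]; last first.
  split=> [||Q Qprime IQ Qsub]; first exact/candidate_prime.
    exact: candidate_parity_ideal.
  apply: eq_candidate => //; first exact: (sign_split_zero_set e_sym Sdis sg_adm sg_split).
  by move=> i j iW jW eij; apply: IQ; apply: parity_edges => //; rewrite inE.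
set S := zero_set P; have SS := subxx S; have [PI _ _] := (prime_idealP P).1 Pprime.
have Pe : contains_edges e P (~: S).
  by move=> i j iW jW eij; apply: IP; apply: parity_edges => //; rewrite inE.
have Pc : cancels P (~: S) by exact: zero_set_cancels.
have [sg [sg_adm Psign]] := prime_admissible_signs e_sym Pprime Pc Pe.
have PE : candidate e S S sg = P.
  apply: Pmin; [exact: candidate_prime | exact: candidate_parity_ideal |].
  apply: candidate_sub => // [i /zero_setP //|side i j bi jC proper].
  have iW : i \in ~: S by case/andP: bi.
  have sub := subsetP (comp_sub e (~: S) i).
  apply: (comp_minor e_sym PI iW) => // [k f /sub|k l /sub kW /sub lW]; first exact: Pc.
  exact: Pe.
have minS s : s \in S ->
    ~ ((bipartite e (component_at e (~: (S :\ s)) s) /\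
         (#|joined_components e S s| <= 1)%N) \/
       (~~ bipartite e (component_at e (~: (S :\ s)) s) /\
         exists b, forall C, C \in joined_components e S s ->
           ~~ bipartite e C /\ sg C = b)).
  move=> sS /(candidate_add_vertex K e_sym sS) [sg' sub].
  have TT := subxx (S :\ s).
  have E : candidate e (S :\ s) (S :\ s) sg' = P.
    apply: Pmin; [exact: candidate_prime | exact: candidate_parity_ideal |].
    by rewrite -PE.
  have sT : s \notin S :\ s by rewrite !inE eqxx.
  have [nx _] := candidate_nvars K e_sym sg' TT sT; apply: nx.
  by rewrite E; case: (zero_setP P s sS).
exists S, (signed_prime e S sg); split=> [s sS||]; last by rewrite -PE.
  rewrite ltnNge; apply/negP => /(s_inv_not_lt e_sym sS)[le1 Hb]; apply: (minS s sS).
  have [bM|nbM] := boolP (bipartite e (component_at e (~: (S :\ s)) s)); first by left.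
  right; split=> //; case: Hb => [bM|nbJ]; first by case/negP: nbM.
  have [J0|[C0 C0J]] := set_0Vmem (joined_components e S s).
    by exists true => C; rewrite J0 inE.
  by exists (sg C0) => C CJ; rewrite nbJ // (card_le1_eqP le1 _ _ CJ C0J).
split; first exact: signed_prime_minimal.
exists sg; split=> // s sS nbJ.
suff same b : ~ (forall C, C \in joined_components e S s -> sg C = b) by split; apply: same.
move=> sgb; apply: (minS s sS).
have [bM|nbM] := boolP (bipartite e (component_at e (~: (S :\ s)) s)).
  left; split=> //; suff -> : joined_components e S s = finset.set0 by rewrite cards0.
  apply/setP => C; rewrite [RHS]inE; apply/negP => CJ.
  by case/negP: (nbJ C CJ); exact: bip_merged_joined CJ.
by right; split=> //; exists b => C CJ; split; [exact: nbJ | exact: sgb].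
Qed.
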